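(* Let $D$ be a positive squarefree integer with $N(\varepsilon)=-1$. Then $Z_D^{\mathrm{odd}}(s)$ and $Z_D^{\mathrm{even}}(s)$ continue meromorphically to $\mathbb{C}$ via \[ Z_D^{\mathrm{odd}}(s)=q^{s/2}\sum_{k\ge0}\binom{-s}{k}\frac{\varepsilon^{s+2k}}{\varepsilon^{2s+4k}-1},\qquad Z_D^{\mathrm{even}}(s)=q^{s/2}\sum_{k\ge0}\binom{-s}{k}\frac{(-1)^k}{\varepsilon^{2s+4k}-1}, \] where the series converge absolutely for all $s$ away from the poles of the summands and agree with the defining Dirichlet series for $\operatorname{Re}s>0$. Both functions have simple poles at $s=-2k+\frac{\pi m}{\log\varepsilon}i$ for $k\in\mathbb{Z}_{\ge0}$, $m\in\mathbb{Z}$.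
   Context: $D$ positive squarefree, $\mathcal{O}_D$ the ring of integers of $\mathbb{Q}(\sqrt D)\subset\mathbb{R}$, $\varepsilon>1$ its fundamental unit, $\overline{\varepsilon}$ its conjugate, $N$ the norm. $q=D$ if $D\equiv1\bmod4$, else $q=4D$. $F_D(n)=(\varepsilon^n-\overline{\varepsilon}^{\,n})/\sqrt q$. For $\operatorname{Re}s>0$, $Z_D^{\mathrm{odd}}(s)=\sum_{n\ge1}F_D(2n-1)^{-s}$ and $Z_D^{\mathrm{even}}(s)=\sum_{n\ge1}F_D(2n)^{-s}$. The generalized binomial coefficient is $\binom{-s}{k}=\frac{(-s)(-s-1)\cdots(-s-k+1)}{k!}$, and $q^{s/2}$, $\varepsilon^{s}$ use real positive bases with principal powers. *)

(* Defs.v *)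
From Stdlib Require Import Reals ZArith Lia.
From Coquelicot Require Import Coquelicot.
Open Scope R_scope.

Definition squarefree (D : Z) : Prop :=
  forall n : Z, (n * n | D)%Z -> (n * n = 1)%Z.

Definition qD (D : Z) : Z := if Z.eqb (D mod 4) 1 then D else (4 * D)%Z.

(** Elements of O_D are written (x + y sqrt D)/2 with integer x, y subject to:
    x = y mod 2 if D = 1 mod 4, and x, y both even otherwise. *)
Definition OD_coords (D x y : Z) : Prop :=
  if Z.eqb (D mod 4) 1 then Z.Even (x - y) else (Z.Even x /\ Z.Even y).

Definition OD_elt (D x y : Z) : R := (IZR x + IZR y * sqrt (IZR D)) / 2.
Definition OD_conj (D x y : Z) : R := (IZR x - IZR y * sqrt (IZR D)) / 2.
Definition OD_norm (D x y : Z) : R := OD_elt D x y * OD_conj D x y.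

Definition OD_unit (D x y : Z) : Prop :=
  OD_coords D x y /\
  exists x' y' : Z, OD_coords D x' y' /\ OD_elt D x y * OD_elt D x' y' = 1.

Definition is_fund_unit (D x y : Z) : Prop :=
  OD_unit D x y /\ 1 < OD_elt D x y /\
  forall x' y' : Z, OD_unit D x' y' -> 1 < OD_elt D x' y' ->
    OD_elt D x y <= OD_elt D x' y'.

Definition F_D (D x y : Z) (n : nat) : R :=
  (OD_elt D x y ^ n - OD_conj D x y ^ n) / sqrt (IZR (qD D)).

Definition cexp (z : C) : C :=
  (exp (Re z) * cos (Im z), exp (Re z) * sin (Im z)).
Definition cpow (a : R) (z : C) : C := cexp (z * RtoC (ln a))%C.

Fixpoint cfalling (z : C) (k : nat) : C :=
  match k with
  | O => 1%C
  | S j => (cfalling z j * (z - RtoC (INR j)))%C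
  end.
Definition cbinom (z : C) (k : nat) : C := (cfalling z k / RtoC (INR (fact k)))%C.

Definition CSeries (a : nat -> C) : C :=
  (Series (fun k => Re (a k)), Series (fun k => Im (a k))).

Definition odd_term (eps : R) (s : C) (k : nat) : C :=
  (cbinom (- s) k * cpow eps (s + RtoC (2 * INR k))
     / (cpow eps (2 * s + RtoC (4 * INR k)) - 1))%C.
Definition even_term (eps : R) (s : C) (k : nat) : C :=
  (cbinom (- s) k * RtoC ((-1) ^ k)
     / (cpow eps (2 * s + RtoC (4 * INR k)) - 1))%C.

Definition Zodd_ext (D x y : Z) (s : C) : C :=
  (cpow (IZR (qD D)) (s / 2) * CSeries (odd_term (OD_elt D x y) s))%C.
Definition Zeven_ext (D x y : Z) (s : C) : C :=
  (cpow (IZR (qD D)) (s / 2) * CSeries (even_term (OD_elt D x y) s))%C.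

Definition pole_set (eps : R) (s : C) : Prop :=
  exists (k : nat) (m : Z), s = (- 2 * INR k, PI * IZR m / ln eps).

Definition simple_pole (f : C -> C) (s0 : C) : Prop :=
  exists c : C, c <> 0%C /\
    filterlim (fun s => ((s - s0) * f s)%C) (locally' s0) (locally c).

(* Main.v *)
Require Import Defs.
From Stdlib Require Import Reals ZArith Lra Lia Psatz.
From Coquelicot Require Import Coquelicot.
Open Scope R_scope.

(** Since the conjugate of [eps] is [- / eps], one has
    [F_D n = eps^n (1 - (-1)^n eps^(-2n)) / sqrt q], so the binomial series gives
    [F_D n ^ (-s) = q^(s/2) * sum_k binom(-s, k) (-(-1)^n)^k v_k^n] with
    [v_k = eps^-(s+2k)].  Summing the geometric series over the [n] of one parity
    gives terms of the form [binom(-s, k) (+-1)^k v_k^e / (1 - v_k^2)], with [e = 1]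
    for odd and [e = 2] for even [n].
    Holomorphy of these series is obtained without Cauchy's formula: the sum of the
    coefficients bounding value, derivative and quadratic remainder of a function at
    a point is submultiplicative, so it can be bounded factor by factor, and the
    bounds for the terms are summable. *)

(** * Absolutely convergent complex series *)


(** Termwise differentiation needs control of the derivatives that is summable in the index, and
    bounds on the values alone would give it only through Cauchy estimates. Hence every term carries
    a bound for its derivative and its remainder from the start. Submultiplicativity with constant 1
    is essential: the [k]-th binomial coefficient is a product of [k] affine factors, so any loss
    per product would be amplified exponentially, whereas here the total cost is replacing [|s|] by
    [|s| + 1]. Every [s0] may be a pole of some term, so uniform bounds are available only for a
    tail: from some index on, [|v_k| <= 1/2] on a disc around [s0], and the finitely many earlier
    terms are treated one by one. A pole of the [k]-th term has real part [-2k], so at most one term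
    is singular at a given point. Its residue contains [binom(-s0, k)], which is nonzero because the
    roots [0, ..., k-1] of the falling factorial all differ from [Re (-s0) = 2k]. Inversion is total
    with [/ 0 = 0], so the series are functions on all of [C], and identities between them are
    proved at the poles as well. *)

Lemma im_le_Cmod (z : C) : Rabs (Im z) <= Cmod z.
Proof. apply Rle_trans with (2 := Rmax_Cmod z), Rmax_r. Qed.

Lemma Cmod_le_Rabs (z : C) : Cmod z <= Rabs (Re z) + Rabs (Im z).
Proof.
  assert (H : z = (RtoC (Re z) + Ci * RtoC (Im z))%C).
  { destruct z; apply injective_projections; simpl; ring. }
  rewrite H at 1.
  eapply Rle_trans; [apply Cmod_triangle|].
  rewrite Cmod_mult, !Cmod_R.
  replace (Cmod Ci) with 1; [lra|].
  unfold Cmod, Ci; simpl.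
  replace (0 * (0 * 1) + 1 * (1 * 1)) with 1 by ring.
  now rewrite sqrt_1.
Qed.

Lemma Cmod_sub_ge (y z : C) : Cmod y - Cmod z <= Cmod (y + z)%C.
Proof.
  generalize (Cmod_triangle (y + z)%C (- z)%C); rewrite Cmod_opp.
  replace (y + z + - z)%C with y by ring.
  lra.
Qed.

Lemma sum_n_C (a : nat -> C) (n : nat) :
  sum_n a n = (sum_n (fun k => Re (a k)) n, sum_n (fun k => Im (a k)) n).
Proof.
  induction n as [|n IH].
  - rewrite !sum_O; now destruct (a 0%nat).
  - rewrite !sum_Sn, IH; reflexivity.
Qed.

(** The uniform structure on [C] is the product one, so a ball is a pair of conditions on the two
    components. *)
Lemma is_series_C (a : nat -> C) (l : C) :
  is_series a l <->
  is_series (fun k => Re (a k)) (Re l) /\ is_series (fun k => Im (a k)) (Im l).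
Proof.
  unfold is_series; split.
  - intros H.
    assert (H' := proj1 (filterlim_locally (F := eventually) _ _) H).
    split; apply (proj2 (filterlim_locally (F := eventually) _ _)); intros eps;
      generalize (H' eps); apply filter_imp; intros n; rewrite sum_n_C;
      intros [H1 H2]; assumption.
  - intros [H1 H2].
    apply (proj2 (filterlim_locally (U := C_UniformSpace) (F := eventually) _ _)).
    intros eps.
    generalize (filter_and _ _ (proj1 (filterlim_locally (F := eventually) _ _) H1 eps)
      (proj1 (filterlim_locally (F := eventually) _ _) H2 eps)).
    apply filter_imp; intros n H; rewrite sum_n_C; exact H.
Qed.

Lemma is_series_C_eq (a b : nat -> C) (l m : C) :
  (forall k, a k = b k) -> l = m -> is_series a l -> is_series b m.
Proof. intros H <-; now apply is_series_ext. Qed.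

Lemma CSeries_unique (a : nat -> C) (l : C) : is_series a l -> CSeries a = l.
Proof.
  intros H; apply is_series_C in H; destruct H as [H1 H2].
  apply injective_projections; apply is_series_unique; assumption.
Qed.

Lemma CSeries_ext (a b : nat -> C) : (forall k, a k = b k) -> CSeries a = CSeries b.
Proof.
  intros H; apply injective_projections; apply Series_ext; intros k; now rewrite H.
Qed.

Lemma ex_series_Rabs_le (a b : nat -> R) :
  (forall k, Rabs (a k) <= b k) -> ex_series b -> ex_series a.
Proof. exact (@ex_series_le R_AbsRing R_CompleteNormedModule a b). Qed.

Lemma ex_series_Cmod_le (a : nat -> C) (b : nat -> R) :
  (forall k, Cmod (a k) <= b k) -> ex_series b -> ex_series (fun k => Cmod (a k)).
Proof.
  intros H; apply ex_series_Rabs_le; intros k.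
  rewrite Rabs_pos_eq; [apply H | apply Cmod_ge_0].
Qed.

Lemma CSeries_correct (a : nat -> C) :
  ex_series (fun k => Cmod (a k)) -> is_series a (CSeries a).
Proof.
  intros H; apply is_series_C; split; apply Series_correct;
    (eapply ex_series_Rabs_le; [|exact H]); intros k;
    [apply re_le_Cmod | apply im_le_Cmod].
Qed.

(** The factor 2 comes from bounding the real and the imaginary sum separately; it is paid once per
    series, never per term. *)
Lemma Cmod_CSeries_le (a : nat -> C) (b : nat -> R) :
  (forall k, Cmod (a k) <= b k) -> ex_series b ->
  Cmod (CSeries a) <= 2 * Series b.
Proof.
  intros H Hb.
  assert (L : forall f : C -> R, (forall z, Rabs (f z) <= Cmod z) ->
    Rabs (Series (fun k => f (a k))) <= Series b).
  { intros f Hf.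
    assert (Hfb : forall k, 0 <= Rabs (f (a k)) <= b k).
    { intros k; split; [apply Rabs_pos|]. now apply Rle_trans with (1 := Hf _). }
    eapply Rle_trans.
    - apply Series_Rabs.
      apply ex_series_Rabs_le with b; [|assumption].
      intros k; rewrite Rabs_Rabsolu; apply Hfb.
    - now apply Series_le. }
  eapply Rle_trans; [apply Cmod_le_Rabs|].
  generalize (L Re re_le_Cmod), (L Im im_le_Cmod); unfold CSeries; simpl; lra.
Qed.

Lemma CSeries_plus (a b : nat -> C) :
  ex_series (fun k => Cmod (a k)) -> ex_series (fun k => Cmod (b k)) ->
  CSeries (fun k => a k + b k)%C = (CSeries a + CSeries b)%C.
Proof.
  intros Ha Hb; apply CSeries_unique.
  exact (is_series_plus _ _ _ _ (CSeries_correct a Ha) (CSeries_correct b Hb)).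
Qed.

Lemma CSeries_scal (c : C) (a : nat -> C) :
  ex_series (fun k => Cmod (a k)) ->
  CSeries (fun k => c * a k)%C = (c * CSeries a)%C.
Proof.
  intros Ha; apply CSeries_unique.
  exact (is_series_scal (V := C_NormedModule) c _ _ (CSeries_correct a Ha)).
Qed.

Lemma CSeries_incr_1 (a : nat -> C) :
  ex_series (fun k => Cmod (a k)) ->
  CSeries a = (a 0%nat + CSeries (fun k => a (S k)))%C.
Proof.
  intros Ha.
  rewrite (CSeries_unique (fun k => a (S k)) (CSeries a - a 0%nat)%C); [ring|].
  apply is_series_incr_1.
  match goal with |- is_series _ ?l => replace l with (CSeries a) end.
  - now apply CSeries_correct.
  - change (CSeries a = (CSeries a - a 0%nat + a 0%nat)%C); ring.
Qed.

(** * Quadratic expansions with submultiplicative bounds *)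

(* In [Type], so that the derivatives of a sequence of functions can be selected
   without a choice axiom. *)
Definition jet (s0 : C) (r : R) (f : C -> C) (M : R) : Type :=
  {d : C | exists m0 m1 m2 : R,
     Cmod (f s0) <= m0 /\ Cmod d <= m1 /\
     (forall h : C, Cmod h < r ->
        Cmod (f (s0 + h) - f s0 - d * h)%C <= m2 * (Cmod h * Cmod h)) /\
     0 <= m2 /\ m0 + m1 + m2 <= M}.

Lemma jet_pos (s0 : C) (r : R) (f : C -> C) M : jet s0 r f M -> 0 <= M.
Proof.
  intros [d (m0 & m1 & m2 & H0 & H1 & _ & H2 & H)].
  generalize (Cmod_ge_0 (f s0)), (Cmod_ge_0 d); lra.
Qed.

Lemma jet_value (s0 : C) (r : R) (f : C -> C) M : jet s0 r f M -> Cmod (f s0) <= M.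
Proof.
  intros [d (m0 & m1 & m2 & H0 & H1 & _ & H2 & H)].
  generalize (Cmod_ge_0 (f s0)), (Cmod_ge_0 d); lra.
Qed.

Lemma jet_bound (s0 : C) (r : R) (f : C -> C) M h :
  r <= 1 -> jet s0 r f M -> Cmod h < r -> Cmod (f (s0 + h)%C) <= M.
Proof.
  intros Hr [d (m0 & m1 & m2 & H0 & H1 & H2 & P2 & H)] Hh.
  specialize (H2 h Hh).
  replace (f (s0 + h)%C) with (f s0 + d * h + (f (s0 + h) - f s0 - d * h))%C by ring.
  generalize (Cmod_triangle (f s0 + d * h)%C (f (s0 + h) - f s0 - d * h)%C),
    (Cmod_triangle (f s0) (d * h)%C); rewrite Cmod_mult.
  generalize (Cmod_ge_0 h), (Cmod_ge_0 d); intros.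
  assert (Cmod d * Cmod h <= m1 * 1) by (apply Rmult_le_compat; lra).
  assert (Cmod h * Cmod h <= 1 * 1) by (apply Rmult_le_compat; lra).
  assert (m2 * (Cmod h * Cmod h) <= m2 * 1) by (apply Rmult_le_compat_l; lra).
  lra.
Qed.

Lemma jet_lipschitz (s0 : C) (r : R) (f : C -> C) M h :
  r <= 1 -> jet s0 r f M -> Cmod h < r ->
  Cmod (f (s0 + h) - f s0)%C <= M * Cmod h.
Proof.
  intros Hr [d (m0 & m1 & m2 & H0 & H1 & H2 & P2 & H)] Hh.
  specialize (H2 h Hh).
  replace (f (s0 + h) - f s0)%C with (d * h + (f (s0 + h) - f s0 - d * h))%C by ring.
  generalize (Cmod_triangle (d * h)%C (f (s0 + h) - f s0 - d * h)%C); rewrite Cmod_mult.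
  generalize (Cmod_ge_0 h), (Cmod_ge_0 d), (Cmod_ge_0 (f s0)); intros.
  assert (Cmod d * Cmod h <= m1 * Cmod h) by (apply Rmult_le_compat_r; lra).
  assert (Cmod h * Cmod h <= 1 * Cmod h) by (apply Rmult_le_compat_r; lra).
  assert (m2 * (Cmod h * Cmod h) <= m2 * (1 * Cmod h)) by (apply Rmult_le_compat_l; lra).
  assert ((m1 + m2) * Cmod h <= M * Cmod h) by (apply Rmult_le_compat_r; lra).
  lra.
Qed.

Lemma jet_weaken (s0 : C) (r r' : R) (f : C -> C) M M' :
  r' <= r -> M <= M' -> jet s0 r f M -> jet s0 r' f M'.
Proof.
  intros Hr HM [d J]; exists d.
  destruct J as (m0 & m1 & m2 & H0 & H1 & H2 & P2 & H).
  exists m0, m1, m2; repeat split; try assumption; try lra.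
  intros h Hh; apply H2; lra.
Qed.

Lemma jet_ext (s0 : C) (r : R) (f g : C -> C) M : (forall s, f s = g s) -> jet s0 r f M -> jet s0 r g M.
Proof.
  intros E [d J]; exists d.
  destruct J as (m0 & m1 & m2 & H0 & H1 & H2 & P2 & H).
  exists m0, m1, m2; rewrite <- E; repeat split; try assumption.
  intros h Hh; rewrite <- E; now apply H2.
Qed.

Lemma jet_affine (s0 : C) (r : R) (a b : C) :
  jet s0 r (fun s => a * s + b)%C (Cmod (a * s0 + b)%C + Cmod a).
Proof.
  exists a, (Cmod (a * s0 + b)%C), (Cmod a), 0; repeat split; try lra.
  intros h _; cbv beta.
  replace (a * (s0 + h) + b - (a * s0 + b) - a * h)%C with (RtoC 0) by ring.
  rewrite Cmod_0; lra.
Qed.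

Lemma jet_const (s0 : C) (r : R) (c : C) : jet s0 r (fun _ => c) (Cmod c).
Proof.
  exists 0%C, (Cmod c), 0, 0; rewrite Cmod_0; repeat split; try lra.
  intros h _.
  replace (c - c - 0 * h)%C with (RtoC 0) by ring.
  rewrite Cmod_0; lra.
Qed.

Lemma jet_plus (s0 : C) (r : R) (f g : C -> C) M N :
  jet s0 r f M -> jet s0 r g N -> jet s0 r (fun s => f s + g s)%C (M + N).
Proof.
  intros [d J] [e J'].
  exists (d + e)%C.
  destruct J as (m0 & m1 & m2 & H0 & H1 & H2 & P2 & H), J' as (n0 & n1 & n2 & K0 & K1 & K2 & Q2 & K).
  exists (m0 + n0), (m1 + n1), (m2 + n2); repeat split; try lra.
  - eapply Rle_trans; [apply Cmod_triangle|lra].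
  - eapply Rle_trans; [apply Cmod_triangle|lra].
  - intros h Hh; specialize (H2 h Hh); specialize (K2 h Hh).
    replace (f (s0 + h) + g (s0 + h) - (f s0 + g s0) - (d + e) * h)%C
      with ((f (s0 + h) - f s0 - d * h) + (g (s0 + h) - g s0 - e * h))%C by ring.
    eapply Rle_trans; [apply Cmod_triangle|lra].
Qed.

(** With remainders [R1], [R2], the remainder of the product is exactly [f s0 * R2 + R1 * g s0 + (d
    * h + R1) * (e * h + R2)]. As [r <= 1], cubic and quartic powers of [Cmod h] are absorbed into
    the square, and each of the nine products [m_i * n_j] is used exactly once. This gives [M * N]
    without loss. *)
Lemma jet_mult (s0 : C) (r : R) (f g : C -> C) M N :
  r <= 1 -> jet s0 r f M -> jet s0 r g N -> jet s0 r (fun s => f s * g s)%C (M * N).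
Proof.
  intros Hr [d J] [e J']; exists (f s0 * e + d * g s0)%C.
  destruct J as (m0 & m1 & m2 & H0 & H1 & H2 & P2 & H),
    J' as (n0 & n1 & n2 & K0 & K1 & K2 & Q2 & K).
  generalize (Cmod_ge_0 (f s0)), (Cmod_ge_0 d), (Cmod_ge_0 (g s0)), (Cmod_ge_0 e).
  intros.
  assert (P0 : 0 <= m0) by lra. assert (P1 : 0 <= m1) by lra.
  assert (Q0 : 0 <= n0) by lra. assert (Q1 : 0 <= n1) by lra.
  exists (m0 * n0), (m0 * n1 + m1 * n0),
    (m0 * n2 + m2 * n0 + m1 * n1 + m1 * n2 + m2 * n1 + m2 * n2).
  repeat split.
  - rewrite Cmod_mult; apply Rmult_le_compat; lra.
  - eapply Rle_trans; [apply Cmod_triangle|].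
    rewrite !Cmod_mult; apply Rplus_le_compat; apply Rmult_le_compat; lra.
  - intros h Hh; specialize (H2 h Hh); specialize (K2 h Hh).
    set (R1 := (f (s0 + h) - f s0 - d * h)%C) in *.
    set (R2 := (g (s0 + h) - g s0 - e * h)%C) in *.
    assert (A1 : Cmod (d * h + R1)%C <= (m1 + m2) * Cmod h).
    { eapply Rle_trans; [apply Cmod_triangle|]. rewrite Cmod_mult.
      generalize (Cmod_ge_0 h); intros.
      assert (Cmod d * Cmod h <= m1 * Cmod h) by (apply Rmult_le_compat_r; lra).
      assert (Cmod h * Cmod h <= 1 * Cmod h) by (apply Rmult_le_compat_r; lra).
      assert (m2 * (Cmod h * Cmod h) <= m2 * (1 * Cmod h)) by (apply Rmult_le_compat_l; lra).
      lra. }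
    assert (A2 : Cmod (e * h + R2)%C <= (n1 + n2) * Cmod h).
    { eapply Rle_trans; [apply Cmod_triangle|]. rewrite Cmod_mult.
      generalize (Cmod_ge_0 h); intros.
      assert (Cmod e * Cmod h <= n1 * Cmod h) by (apply Rmult_le_compat_r; lra).
      assert (Cmod h * Cmod h <= 1 * Cmod h) by (apply Rmult_le_compat_r; lra).
      assert (n2 * (Cmod h * Cmod h) <= n2 * (1 * Cmod h)) by (apply Rmult_le_compat_l; lra).
      lra. }
    replace (f (s0 + h) * g (s0 + h) - f s0 * g s0 - (f s0 * e + d * g s0) * h)%C
      with (f s0 * R2 + R1 * g s0 + (d * h + R1) * (e * h + R2))%C
      by (unfold R1, R2; ring).
    eapply Rle_trans; [apply Cmod_triangle|].
    eapply Rle_trans; [apply Rplus_le_compat_r, Cmod_triangle|].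
    rewrite !Cmod_mult.
    assert (B1 : Cmod (f s0) * Cmod R2 <= m0 * (n2 * (Cmod h * Cmod h)))
      by (apply Rmult_le_compat; try apply Cmod_ge_0; lra).
    assert (B2 : Cmod R1 * Cmod (g s0) <= (m2 * (Cmod h * Cmod h)) * n0)
      by (apply Rmult_le_compat; try apply Cmod_ge_0; lra).
    assert (B3 : Cmod (d * h + R1)%C * Cmod (e * h + R2)%C
      <= ((m1 + m2) * Cmod h) * ((n1 + n2) * Cmod h))
      by (apply Rmult_le_compat; try apply Cmod_ge_0; lra).
    lra.
  - repeat apply Rplus_le_le_0_compat; apply Rmult_le_pos; lra.
  - apply Rle_trans with ((m0 + m1 + m2) * (n0 + n1 + n2)).
    + right; ring.
    + apply Rmult_le_compat; lra.
Qed.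

(** The three summands come from the value [/ delta], the derivative [- d / f(s0)^2], and the
    remainder [- R1 / f(s0)^2 + (f - f(s0))^2 / (f(s0)^2 * f)], where [f - f(s0)] is controlled by
    the Lipschitz bound. *)
Lemma jet_inv (s0 : C) (r : R) (f : C -> C) M delta :
  0 < r -> r <= 1 -> 0 < delta ->
  (forall h, Cmod h < r -> delta <= Cmod (f (s0 + h)%C)) ->
  jet s0 r f M ->
  jet s0 r (fun s => / f s)%C
    (/ delta + 2 * M * / delta ^ 2 + M ^ 2 * / delta ^ 3).
Proof.
  intros Hr0 Hr Hd Hlow J.
  generalize (jet_pos _ _ _ _ J); intros PM.
  assert (Hlip : forall h, Cmod h < r -> Cmod (f (s0 + h) - f s0)%C <= M * Cmod h)
    by (intros h; apply jet_lipschitz; assumption).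
  destruct J as [d J]; exists (- d * (/ f s0 * / f s0))%C.
  destruct J as (m0 & m1 & m2 & H0 & H1 & H2 & P2 & H).
  generalize (Cmod_ge_0 (f s0)), (Cmod_ge_0 d); intros.
  assert (Hne : forall h, Cmod h < r -> f (s0 + h)%C <> 0%C).
  { intros h Hh E; specialize (Hlow h Hh); rewrite E, Cmod_0 in Hlow; lra. }
  assert (Hinv : forall h, Cmod h < r -> Cmod (/ f (s0 + h)%C) <= / delta).
  { intros h Hh; rewrite Cmod_inv by now apply Hne.
    apply Rinv_le_contravar; auto. }
  assert (Hne0 : f s0 <> 0%C).
  { generalize (Hne 0%C); rewrite Cplus_0_r, Cmod_0; auto. }
  assert (Hinv0 : Cmod (/ f s0) <= / delta).
  { generalize (Hinv 0%C); rewrite Cplus_0_r, Cmod_0; auto. }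
  assert (Pd : 0 < / delta) by now apply Rinv_0_lt_compat.
  assert (Hinv00 : Cmod (/ f s0)%C * Cmod (/ f s0)%C <= / delta * / delta)
    by (apply Rmult_le_compat; try apply Cmod_ge_0; lra).
  exists (/ delta), (M * / delta ^ 2),
    (M * / delta ^ 2 + M ^ 2 * / delta ^ 3).
  replace (/ delta ^ 2) with (/ delta * / delta) by (field; lra).
  replace (/ delta ^ 3) with (/ delta * / delta * / delta) by (field; lra).
  repeat split.
  - assumption.
  - rewrite !Cmod_mult, Cmod_opp.
    apply Rmult_le_compat; try lra.
    apply Rmult_le_pos; apply Cmod_ge_0.
  - intros h Hh; specialize (H2 h Hh); specialize (Hlip h Hh).
    generalize (Hinv h Hh) (Hne h Hh); intros Hi Hn.
    set (R1 := (f (s0 + h) - f s0 - d * h)%C) in *.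
    replace (/ f (s0 + h) - / f s0 - - d * (/ f s0 * / f s0) * h)%C
      with (- (R1 * (/ f s0 * / f s0))
              + ((f (s0 + h) - f s0) * (f (s0 + h) - f s0))
                * (/ f s0 * / f s0 * / f (s0 + h)))%C
      by (unfold R1; field; split; assumption).
    eapply Rle_trans; [apply Cmod_triangle|].
    rewrite Cmod_opp, !Cmod_mult.
    generalize (Cmod_ge_0 h); intros Ph.
    assert (B1 : Cmod R1 * (Cmod (/ f s0) * Cmod (/ f s0))
      <= (M * (Cmod h * Cmod h)) * (/ delta * / delta)).
    { apply Rmult_le_compat; try lra.
      - apply Cmod_ge_0.
      - apply Rmult_le_pos; apply Cmod_ge_0.
      - eapply Rle_trans; [exact H2|]. apply Rmult_le_compat_r; [|lra].
        now apply Rmult_le_pos. }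
    assert (B2 : Cmod (f (s0 + h) - f s0)%C * Cmod (f (s0 + h) - f s0)%C
      <= (M * Cmod h) * (M * Cmod h))
      by (apply Rmult_le_compat; try apply Cmod_ge_0; lra).
    assert (B3 : Cmod (/ f s0)%C * Cmod (/ f s0)%C * Cmod (/ f (s0 + h))%C
      <= / delta * / delta * / delta).
    { apply Rmult_le_compat; try lra; [|apply Cmod_ge_0].
      apply Rmult_le_pos; apply Cmod_ge_0. }
    assert (B4 : Cmod (f (s0 + h) - f s0)%C * Cmod (f (s0 + h) - f s0)%C *
       (Cmod (/ f s0)%C * Cmod (/ f s0)%C * Cmod (/ f (s0 + h))%C)
      <= (M * Cmod h) * (M * Cmod h) * (/ delta * / delta * / delta)).
    { apply Rmult_le_compat; try lra; repeat apply Rmult_le_pos; apply Cmod_ge_0. }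
    lra.
  - assert (0 <= M * (/ delta * / delta)) by (apply Rmult_le_pos; [lra|apply Rmult_le_pos; lra]).
    assert (0 <= M ^ 2 * (/ delta * / delta * / delta)).
    { apply Rmult_le_pos; [apply pow_le; lra|]; repeat apply Rmult_le_pos; lra. }
    lra.
  - lra.
Qed.

(** [M k] dominates each of the three coefficients of the [k]-th term, so values, derivatives and
    remainders can all be summed. Each sum is at most [2 * Series M], whence the 6. *)
Lemma jet_CSeries (s0 : C) (r : R) (f : nat -> C -> C) (M : nat -> R) :
  r <= 1 -> (forall k, jet s0 r (f k) (M k)) -> ex_series M ->
  jet s0 r (fun s => CSeries (fun k => f k s)) (6 * Series M).
Proof.
  intros Hr J HM.
  assert (V : forall h, Cmod h < r -> forall k, Cmod (f k (s0 + h)%C) <= M k).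
  { intros h Hh k; apply jet_bound with r; auto. }
  assert (V0 : forall k, Cmod (f k s0) <= M k).
  { intros k; apply jet_value with r; auto. }
  set (d := fun k => proj1_sig (J k)).
  assert (D : forall k, Cmod (d k) <= M k).
  { intros k; unfold d; destruct (J k) as [e (m0 & m1 & m2 & H0 & H1 & H2 & P2 & H)]; simpl.
    generalize (Cmod_ge_0 (f k s0)); lra. }
  assert (Rem : forall h, Cmod h < r -> forall k,
    Cmod (f k (s0 + h) - f k s0 - d k * h)%C <= M k * (Cmod h * Cmod h)).
  { intros h Hh k; unfold d; destruct (J k) as [e (m0 & m1 & m2 & H0 & H1 & H2 & P2 & H)]; simpl.
    eapply Rle_trans; [now apply H2|].
    generalize (Cmod_ge_0 (f k s0)), (Cmod_ge_0 e); intros.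
    apply Rmult_le_compat_r; [|lra].
    apply Rmult_le_pos; apply Cmod_ge_0. }
  assert (Pos : 0 <= Series M).
  { generalize (Cmod_CSeries_le d M D HM), (Cmod_ge_0 (CSeries d)); lra. }
  exists (CSeries d), (2 * Series M), (2 * Series M), (2 * Series M).
  repeat split; try lra.
  - now apply Cmod_CSeries_le.
  - now apply Cmod_CSeries_le.
  - intros h Hh.
    assert (S1 := ex_series_Cmod_le _ _ (V h Hh) HM).
    assert (S2 := ex_series_Cmod_le _ _ V0 HM).
    assert (S3 := ex_series_Cmod_le _ _ D HM).
    replace (CSeries (fun k => f k (s0 + h)%C) - CSeries (fun k => f k s0) - CSeries d * h)%C
      with (CSeries (fun k => f k (s0 + h) - f k s0 - d k * h)%C).
    + assert (HM' : ex_series (fun k => M k * (Cmod h * Cmod h))).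
      { apply ex_series_scal_r; assumption. }
      eapply Rle_trans; [apply (Cmod_CSeries_le _ _ (Rem h Hh) HM')|].
      rewrite Series_scal_r; right; ring.
    + apply CSeries_unique.
      assert (T1 := CSeries_correct _ S1).
      assert (T2 := is_series_scal (V := C_NormedModule) (-(1))%C _ _ (CSeries_correct _ S2)).
      assert (T3 := is_series_scal (V := C_NormedModule) (- h)%C _ _ (CSeries_correct _ S3)).
      assert (T := is_series_plus _ _ _ _ (is_series_plus _ _ _ _ T1 T2) T3).
      eapply is_series_C_eq; [| |exact T].
      * intros k.
        change (f k (s0 + h) + (-(1)) * f k s0 + - h * d k = f k (s0 + h) - f k s0 - d k * h)%C; ring.
      * change (CSeries (fun k => f k (s0 + h)) + (-(1)) * CSeries (fun k => f k s0) + - h * CSeries d = CSeries (fun k => f k (s0 + h)) - CSeries (fun k => f k s0) - CSeries d * h)%C; ring.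
Qed.


(** * Holomorphy at a point *)

(** The qualitative form, for single functions whose radius and bound do not matter; [inhabited]
    brings the informative [jet] back into [Prop]. *)
Definition hol (s0 : C) (f : C -> C) : Prop :=
  exists r M : R, 0 < r <= 1 /\ inhabited (jet s0 r f M).

Lemma hol_affine (s0 : C) (a b : C) : hol s0 (fun s => a * s + b)%C.
Proof. exists 1, (Cmod (a * s0 + b)%C + Cmod a); split; [lra|]. constructor; apply jet_affine. Qed.

Lemma hol_const (s0 : C) (c : C) : hol s0 (fun _ => c).
Proof. exists 1, (Cmod c); split; [lra|]. constructor; apply jet_const. Qed.

Lemma hol_ext (s0 : C) (f g : C -> C) : (forall s, f s = g s) -> hol s0 f -> hol s0 g.
Proof.
  intros E (r & M & Hr & [J]); exists r, M; split; [assumption|].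
  constructor; now apply jet_ext with f.
Qed.

Lemma hol_common_radius (s0 : C) (f g : C -> C) : hol s0 f -> hol s0 g ->
  exists r M N, 0 < r <= 1 /\ inhabited (jet s0 r f M) /\ inhabited (jet s0 r g N).
Proof.
  intros (r1 & M & Hr1 & [J1]) (r2 & N & Hr2 & [J2]).
  exists (Rmin r1 r2), M, N.
  assert (0 < Rmin r1 r2) by (apply Rmin_glb_lt; lra).
  generalize (Rmin_l r1 r2), (Rmin_r r1 r2); intros.
  repeat split; try lra.
  - apply (jet_weaken s0 r1 _ f M M); [assumption|apply Rle_refl|assumption].
  - apply (jet_weaken s0 r2 _ g N N); [assumption|apply Rle_refl|assumption].
Qed.

Lemma hol_plus (s0 : C) (f g : C -> C) : hol s0 f -> hol s0 g -> hol s0 (fun s => f s + g s)%C.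
Proof.
  intros Hf Hg; destruct (hol_common_radius s0 f g Hf Hg) as (r & M & N & Hr & [J1] & [J2]).
  exists r, (M + N); split; [assumption|]; constructor; now apply jet_plus.
Qed.

Lemma hol_mult (s0 : C) (f g : C -> C) : hol s0 f -> hol s0 g -> hol s0 (fun s => f s * g s)%C.
Proof.
  intros Hf Hg; destruct (hol_common_radius s0 f g Hf Hg) as (r & M & N & Hr & [J1] & [J2]).
  exists r, (M * N); split; [assumption|]; constructor; apply jet_mult; [lra|..]; assumption.
Qed.

Lemma hol_pow (s0 : C) (f : C -> C) n : hol s0 f -> hol s0 (fun s => Cpow (f s) n).
Proof.
  intros Hf; induction n as [|n IH]; simpl; [apply hol_const|now apply hol_mult].
Qed.

Lemma hol_inv (s0 : C) (f : C -> C) : f s0 <> 0%C -> hol s0 f -> hol s0 (fun s => / f s)%C.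
Proof.
  intros Hne (r & M & Hr & [J]).
  apply (proj1 (Cmod_gt_0 _)) in Hne.
  generalize (jet_pos _ _ _ _ J); intros PM.
  (* On this radius the Lipschitz bound moves [f] by at most half of [Cmod (f s0)]; [M + 1] avoids
     dividing by zero. *)
  set (r' := Rmin r (Cmod (f s0) / 2 / (M + 1))).
  assert (Hr' : 0 < r').
  { apply Rmin_glb_lt; [lra|]. apply Rdiv_lt_0_compat; lra. }
  assert (Hr'r : r' <= r) by apply Rmin_l.
  assert (Hr'2 : r' * (M + 1) <= Cmod (f s0) / 2).
  { apply Rle_trans with (Cmod (f s0) / 2 / (M + 1) * (M + 1)).
    - apply Rmult_le_compat_r; [lra|apply Rmin_r].
    - right; field; lra. }
  eexists r', _; split; [lra|].
  constructor.
  apply jet_inv with (delta := Cmod (f s0) / 2); try lra.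
  - intros h Hh.
    assert (L := jet_lipschitz s0 r f M h (proj2 Hr) J (Rlt_le_trans _ _ _ Hh Hr'r)).
    generalize (Cmod_sub_ge (f s0) (f (s0 + h) - f s0)%C).
    replace (f s0 + (f (s0 + h) - f s0))%C with (f (s0 + h)%C) by ring.
    generalize (Cmod_ge_0 h); intros.
    assert (M * Cmod h <= (M + 1) * r') by (apply Rmult_le_compat; lra).
    lra.
  - apply (jet_weaken s0 r _ f M M); [assumption|apply Rle_refl|assumption].
Qed.

Lemma ex_derive_hol (s0 : C) (f : C -> C) : hol s0 f -> @ex_derive C_AbsRing C_NormedModule f s0.
Proof.
  intros (r & M & Hr & [J]).
  generalize (jet_pos _ _ _ _ J); intros PM.
  destruct J as [d (m0 & m1 & m2 & H0 & H1 & H2 & P2 & H)].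
  exists d; split; [apply is_linear_scal_l|].
  intros x Hx.
  apply (is_filter_lim_locally_unique (K := C_AbsRing) (V := AbsRing_NormedModule C_AbsRing)) in Hx.
  subst x.
  intros eps.
  assert (Heps := cond_pos eps).
  assert (Hd : 0 < Rmin r (eps / (m2 + 1))).
  { apply Rmin_glb_lt; [lra|]. apply Rdiv_lt_0_compat; lra. }
  exists (mkposreal _ Hd).
  change (forall s : C, Cmod (s - s0)%C < Rmin r (eps / (m2 + 1)) ->
    Cmod ((f s - f s0) - (s - s0) * d)%C <= eps * Cmod (s - s0)%C).
  intros s Hs.
  assert (Hs1 := Rlt_le_trans _ _ _ Hs (Rmin_l _ _)).
  assert (Hs2 := Rlt_le_trans _ _ _ Hs (Rmin_r _ _)).
  specialize (H2 (s - s0)%C Hs1).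
  replace (s0 + (s - s0))%C with s in H2 by ring.
  replace (f s - f s0 - (s - s0) * d)%C with (f s - f s0 - d * (s - s0))%C by ring.
  eapply Rle_trans; [exact H2|].
  generalize (Cmod_ge_0 (s - s0)%C); intros P.
  rewrite <- Rmult_assoc; apply Rmult_le_compat_r; [assumption|].
  apply Rle_trans with ((m2 + 1) * (eps / (m2 + 1))).
  - apply Rmult_le_compat; lra.
  - right; field; lra.
Qed.

(** The first [K] terms are split off one at a time, so their radii may be unrelated; only the tail
    needs a common [r]. Summability is required at every [s] because the splitting is used as an
    identity of functions on all of [C]. *)
Lemma hol_CSeries (f : nat -> C -> C) (s0 : C) (K : nat) (r : R) (M : nat -> R) :
  (forall s, ex_series (fun k => Cmod (f k s))) ->
  (forall k, (k < K)%nat -> hol s0 (f k)) ->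
  0 < r <= 1 -> (forall k, jet s0 r (f (K + k)%nat) (M k)) -> ex_series M ->
  hol s0 (fun s => CSeries (fun k => f k s)).
Proof.
  intros Hs Hk Hr J HM; revert f Hs Hk J.
  induction K as [|K IH]; intros f Hs Hk J.
  - exists r, (6 * Series M); split; [assumption|].
    constructor; apply jet_CSeries; try assumption; lra.
  - apply hol_ext with (fun s => f 0%nat s + CSeries (fun k => f (S k) s))%C.
    + intros s; symmetry; exact (CSeries_incr_1 (fun k => f k s) (Hs s)).
    + apply hol_plus; [apply Hk; lia|].
      apply (IH (fun k => f (S k))).
      * intros s; now apply (ex_series_incr_1 (fun k => Cmod (f k s))).
      * intros k H; apply Hk; lia.
      * exact J.
Qed.

(** * Punctured limits *)

(** Stated with [Cmod], which is multiplicative, rather than with the product balls of [C];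
    [limC_filterlim] converts at the end. *)
Definition limC (s0 : C) (f : C -> C) (c : C) : Prop :=
  forall eps, 0 < eps -> exists delta, 0 < delta /\
    forall s, s <> s0 -> Cmod (s - s0)%C < delta -> Cmod (f s - c)%C < eps.

Lemma limC_hol (s0 : C) (f : C -> C) : hol s0 f -> limC s0 f (f s0).
Proof.
  intros (r & M & Hr & [J]) eps Heps.
  generalize (jet_pos _ _ _ _ J); intros PM.
  exists (Rmin r (eps / (M + 1))); split.
  { apply Rmin_glb_lt; [lra|]. apply Rdiv_lt_0_compat; lra. }
  intros s _ Hs.
  assert (Hs1 := Rlt_le_trans _ _ _ Hs (Rmin_l _ _)).
  assert (Hs2 := Rlt_le_trans _ _ _ Hs (Rmin_r _ _)).
  assert (L := jet_lipschitz s0 r f M (s - s0)%C (proj2 Hr) J Hs1).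
  replace (s0 + (s - s0))%C with s in L by ring.
  generalize (Cmod_ge_0 (s - s0)%C); intros P.
  apply Rle_lt_trans with (1 := L).
  apply Rle_lt_trans with ((M + 1) * Cmod (s - s0)%C); [lra|].
  replace eps with ((M + 1) * (eps / (M + 1))) by (field; lra).
  apply Rmult_lt_compat_l; lra.
Qed.

Lemma limC_ext (s0 : C) (f g : C -> C) (c : C) : (forall s, s <> s0 -> f s = g s) -> limC s0 f c -> limC s0 g c.
Proof.
  intros E H eps Heps; destruct (H eps Heps) as (delta & Hd & K).
  exists delta; split; [assumption|]; intros s Hs; rewrite <- E by assumption; now apply K.
Qed.

Lemma limC_plus (s0 : C) (f g : C -> C) (a b : C) :
  limC s0 f a -> limC s0 g b -> limC s0 (fun s => f s + g s)%C (a + b)%C.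
Proof.
  intros Hf Hg eps Heps.
  destruct (Hf (eps / 2)) as (d1 & P1 & H1); [lra|].
  destruct (Hg (eps / 2)) as (d2 & P2 & H2); [lra|].
  exists (Rmin d1 d2); split; [now apply Rmin_glb_lt|].
  intros s Hne Hs.
  specialize (H1 s Hne (Rlt_le_trans _ _ _ Hs (Rmin_l _ _))).
  specialize (H2 s Hne (Rlt_le_trans _ _ _ Hs (Rmin_r _ _))).
  replace (f s + g s - (a + b))%C with ((f s - a) + (g s - b))%C by ring.
  eapply Rle_lt_trans; [apply Cmod_triangle|lra].
Qed.

Lemma limC_mult (s0 : C) (f g : C -> C) (a b : C) :
  limC s0 f a -> limC s0 g b -> limC s0 (fun s => f s * g s)%C (a * b)%C.
Proof.
  intros Hf Hg eps Heps.
  generalize (Cmod_ge_0 a), (Cmod_ge_0 b); intros Pa Pb.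
  set (e := Rmin 1 (eps / (Cmod a + Cmod b + 1))).
  assert (He : 0 < e).
  { apply Rmin_glb_lt; [lra|]. apply Rdiv_lt_0_compat; lra. }
  assert (He1 : e <= 1) by apply Rmin_l.
  assert (He2 : (Cmod a + Cmod b + 1) * e <= eps).
  { apply Rle_trans with ((Cmod a + Cmod b + 1) * (eps / (Cmod a + Cmod b + 1))).
    - apply Rmult_le_compat_l; [lra|apply Rmin_r].
    - right; field; lra. }
  destruct (Hf e He) as (d1 & P1 & H1).
  destruct (Hg e He) as (d2 & P2 & H2).
  exists (Rmin d1 d2); split; [now apply Rmin_glb_lt|].
  intros s Hne Hs.
  specialize (H1 s Hne (Rlt_le_trans _ _ _ Hs (Rmin_l _ _))).
  specialize (H2 s Hne (Rlt_le_trans _ _ _ Hs (Rmin_r _ _))).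
  replace (f s * g s - a * b)%C
    with ((f s - a) * (g s - b) + (a * (g s - b) + (f s - a) * b))%C by ring.
  eapply Rle_lt_trans; [apply Cmod_triangle|].
  eapply Rle_lt_trans; [apply Rplus_le_compat_l, Cmod_triangle|].
  rewrite !Cmod_mult.
  generalize (Cmod_ge_0 (f s - a)%C), (Cmod_ge_0 (g s - b)%C); intros.
  assert (Cmod (f s - a)%C * Cmod (g s - b)%C < e * 1)
    by (apply Rmult_le_0_lt_compat; lra).
  assert (Cmod a * Cmod (g s - b)%C <= Cmod a * e) by (apply Rmult_le_compat_l; lra).
  assert (Cmod (f s - a)%C * Cmod b <= e * Cmod b) by (apply Rmult_le_compat_r; lra).
  lra.
Qed.

Lemma limC_inv (s0 : C) (f : C -> C) (a : C) : a <> 0%C -> limC s0 f a -> limC s0 (fun s => / f s)%C (/ a)%C.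
Proof.
  intros Ha Hf eps Heps.
  assert (Pa := proj1 (Cmod_gt_0 a) Ha).
  set (m := Cmod a) in *.
  (* The first bound keeps [Cmod (f s)] above [m / 2]; the second then makes the error at most
     [eps / 2]. *)
  set (e := Rmin (m / 2) (eps * (m * m) / 4)).
  assert (Pm : 0 < m * m) by now apply Rmult_lt_0_compat.
  assert (He : 0 < e).
  { apply Rmin_glb_lt; [lra|]. generalize (Rmult_lt_0_compat _ _ Heps Pm); lra. }
  destruct (Hf e He) as (d & Pd & H).
  exists d; split; [assumption|]; intros s Hne Hs.
  specialize (H s Hne Hs).
  assert (H1 := Rlt_le_trans _ _ _ H (Rmin_l _ _)).
  assert (H2 := Rlt_le_trans _ _ _ H (Rmin_r _ _)).
  assert (L : m / 2 <= Cmod (f s)).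
  { generalize (Cmod_sub_ge a (f s - a)%C).
    replace (a + (f s - a))%C with (f s) by ring. fold m; lra. }
  assert (Hn : f s <> 0%C) by (apply Cmod_gt_0; lra).
  replace (/ f s - / a)%C with (- ((f s - a) * (/ f s * / a)))%C by (field; auto).
  rewrite Cmod_opp, !Cmod_mult, !Cmod_inv by assumption; fold m.
  assert (/ Cmod (f s) <= / (m / 2)) by (apply Rinv_le_contravar; lra).
  assert (0 < / Cmod (f s)) by (apply Rinv_0_lt_compat; lra).
  assert (0 < / m) by (apply Rinv_0_lt_compat; lra).
  apply Rle_lt_trans with (Cmod (f s - a)%C * (/ (m / 2) * / m)).
  - apply Rmult_le_compat_l; [apply Cmod_ge_0|]. apply Rmult_le_compat_r; lra.
  - apply Rlt_le_trans with (eps * (m * m) / 4 * (/ (m / 2) * / m)).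
    + apply Rmult_lt_compat_r; [|assumption].
      apply Rmult_lt_0_compat; [apply Rinv_0_lt_compat; lra|assumption].
    + replace (eps * (m * m) / 4 * (/ (m / 2) * / m)) with (eps / 2) by (field; lra). lra.
Qed.

Lemma limC_filterlim (s0 : C) (f : C -> C) (c : C) : limC s0 f c -> filterlim f (locally' s0) (locally c).
Proof.
  intros H.
  apply (proj2 (filterlim_locally (U := C_UniformSpace) _ _)); intros eps.
  destruct (H eps (cond_pos eps)) as (d & Pd & K).
  (* A product ball of radius [d / 2] lies in the [Cmod] disc of radius [d]. *)
  assert (Pd2 : 0 < d / 2) by lra.
  exists (mkposreal _ Pd2); change (forall s : C, ball s0 (d / 2) s -> s <> s0 -> ball c eps (f s)).
  intros s [B1 B2] Hne.
  change (Rabs (Re s - Re s0) < d / 2) in B1.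
  change (Rabs (Im s - Im s0) < d / 2) in B2.
  assert (D : Cmod (s - s0)%C < d).
  { eapply Rle_lt_trans; [apply Cmod_le_Rabs|].
    change (Rabs (Re s - Re s0) + Rabs (Im s - Im s0) < d); lra. }
  specialize (K s Hne D); split.
  - eapply Rle_lt_trans; [exact (re_le_Cmod (f s - c)%C)|assumption].
  - eapply Rle_lt_trans; [exact (im_le_Cmod (f s - c)%C)|assumption].
Qed.

(** Takes the jet itself rather than [hol], because the residue computation needs to know which
    derivative the jet contains. *)
Lemma limC_slope (s0 : C) (f : C -> C) r M (J : jet s0 r f M) :
  0 < r -> limC s0 (fun s => (f s - f s0) / (s - s0))%C (proj1_sig J).
Proof.
  intros Hr eps Heps.
  destruct J as [d (m0 & m1 & m2 & H0 & H1 & H2 & P2 & H)]; simpl.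
  exists (Rmin r (eps / (m2 + 1))); split.
  { apply Rmin_glb_lt; [lra|]. apply Rdiv_lt_0_compat; lra. }
  intros s Hne Hs.
  assert (Hs1 := Rlt_le_trans _ _ _ Hs (Rmin_l _ _)).
  assert (Hs2 := Rlt_le_trans _ _ _ Hs (Rmin_r _ _)).
  specialize (H2 (s - s0)%C Hs1).
  replace (s0 + (s - s0))%C with s in H2 by ring.
  assert (Hn : (s - s0)%C <> 0%C).
  { intros E; apply Hne; replace s with ((s - s0) + s0)%C by ring; rewrite E; ring. }
  assert (Pn := proj1 (Cmod_gt_0 _) Hn).
  replace ((f s - f s0) / (s - s0) - d)%C
    with ((f s - f s0 - d * (s - s0)) * / (s - s0))%C by (field; assumption).
  rewrite Cmod_mult, Cmod_inv by assumption.
  apply Rle_lt_trans with (m2 * (Cmod (s - s0)%C * Cmod (s - s0)%C) * / Cmod (s - s0)%C).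
  - apply Rmult_le_compat_r; [left; now apply Rinv_0_lt_compat|assumption].
  - replace (m2 * (Cmod (s - s0)%C * Cmod (s - s0)%C) * / Cmod (s - s0)%C)
      with (m2 * Cmod (s - s0)%C) by (field; lra).
    apply Rle_lt_trans with ((m2 + 1) * Cmod (s - s0)%C); [lra|].
    replace eps with ((m2 + 1) * (eps / (m2 + 1))) by (field; lra).
    apply Rmult_lt_compat_l; lra.
Qed.

(** * The complex exponential *)

Lemma cexp_plus (z w : C) : cexp (z + w)%C = (cexp z * cexp w)%C.
Proof.
  destruct z as [a b], w as [c d]; unfold cexp; simpl.
  rewrite exp_plus, cos_plus, sin_plus.
  apply injective_projections; simpl; ring.
Qed.

Lemma cexp_0 : cexp 0%C = 1%C.
Proof.
  unfold cexp; simpl; rewrite exp_0, cos_0, sin_0.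
  apply injective_projections; simpl; ring.
Qed.

Lemma cexp_RtoC (x : R) : cexp (RtoC x) = RtoC (exp x).
Proof.
  unfold cexp; simpl; rewrite cos_0, sin_0.
  apply injective_projections; simpl; ring.
Qed.

Lemma cexp_opp_l (z : C) : (cexp (- z) * cexp z)%C = 1%C.
Proof. rewrite <- cexp_plus, <- cexp_0; f_equal; ring. Qed.

Lemma cexp_neq_0 (z : C) : cexp z <> 0%C.
Proof.
  intros E; assert (H := cexp_opp_l z); rewrite E, Cmult_0_r in H.
  apply (f_equal Re) in H; simpl in H; lra.
Qed.

Lemma cexp_opp (z : C) : cexp (- z)%C = (/ cexp z)%C.
Proof.
  rewrite <- (Cmult_1_r (cexp (- z))), <- (Cinv_r (cexp z)) by apply cexp_neq_0.
  rewrite Cmult_assoc, cexp_opp_l; ring.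
Qed.

Lemma Cmod_cexp (z : C) : Cmod (cexp z) = exp (Re z).
Proof.
  unfold Cmod, cexp; simpl.
  transitivity (sqrt (Rsqr (exp (Re z)))).
  - f_equal; generalize (sin2_cos2 (Im z)); unfold Rsqr; intros H.
    transitivity (exp (Re z) * exp (Re z)
      * (sin (Im z) * sin (Im z) + cos (Im z) * cos (Im z))); [ring|rewrite H; ring].
  - apply sqrt_Rsqr; left; apply exp_pos.
Qed.

Lemma cexp_mult_INR (z : C) (n : nat) : cexp (RtoC (INR n) * z)%C = Cpow (cexp z) n.
Proof.
  induction n as [|n IH].
  - simpl INR; rewrite Cmult_0_l; apply cexp_0.
  - rewrite S_INR, RtoC_plus; simpl Cpow; rewrite <- IH, <- cexp_plus; f_equal; ring.
Qed.

Lemma Rabs_sin_le (t : R) : Rabs (sin t) <= Rabs t.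
Proof.
  destruct (MVT_gen sin 0 t cos) as (c & _ & E).
  - intros; apply is_derive_Reals, derivable_pt_lim_sin.
  - intros; apply continuity_sin.
  - rewrite sin_0, !Rminus_0_r in E; rewrite E, Rabs_mult.
    rewrite <- (Rmult_1_l (Rabs t)) at 2.
    apply Rmult_le_compat_r; [apply Rabs_pos|].
    apply Rabs_le; generalize (COS_bound c); lra.
Qed.

Lemma Rabs_cos_sub_1_le (t : R) : Rabs (cos t - 1) <= t * t.
Proof.
  replace t with (2 * (t / 2)) at 1 by field.
  rewrite cos_2a_sin.
  replace (1 - 2 * sin (t / 2) * sin (t / 2) - 1) with (- (2 * (sin (t / 2) * sin (t / 2)))) by ring.
  rewrite Rabs_Ropp, !Rabs_mult.
  generalize (Rabs_sin_le (t / 2)); intros H.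
  assert (H2 : Rabs (sin (t / 2)) * Rabs (sin (t / 2)) <= Rabs (t / 2) * Rabs (t / 2))
    by (apply Rmult_le_compat; try apply Rabs_pos; assumption).
  rewrite <- (Rabs_mult (t / 2)), (Rabs_pos_eq (t / 2 * (t / 2))) in H2 by nra.
  rewrite (Rabs_pos_eq 2) by lra. nra.
Qed.

Lemma Rabs_sin_sub_le (t : R) : Rabs t <= 1 -> Rabs (sin t - t) <= t * t.
Proof.
  intros Ht.
  destruct (MVT_gen (fun x => sin x - x) 0 t (fun x => cos x - 1)) as (c & Hc & E).
  - intros; auto_derive; [easy|ring].
  - intros; apply continuity_pt_minus; [apply continuity_sin|apply derivable_continuous_pt, derivable_pt_id].
  - rewrite sin_0, !Rminus_0_r in E; rewrite E, Rabs_mult.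
    assert (Hct : Rabs c <= Rabs t).
    { revert Hc; unfold Rmin, Rmax; destruct (Rle_dec 0 t); intros.
      - rewrite !Rabs_pos_eq; lra.
      - rewrite !Rabs_left1; lra. }
    assert (Hcc : c * c <= Rabs t).
    { apply Rle_trans with (Rabs c * Rabs c).
      - rewrite <- Rabs_mult; apply Rle_abs.
      - replace (Rabs t) with (Rabs t * 1) by ring.
        apply Rmult_le_compat; try apply Rabs_pos; lra. }
    replace (t * t) with (Rabs t * Rabs t).
    + apply Rmult_le_compat_r; [apply Rabs_pos|].
      now apply Rle_trans with (1 := Rabs_cos_sub_1_le c).
    + rewrite <- Rabs_mult; apply Rabs_pos_eq; nra.
Qed.

(** From [exp (- x) >= 1 - x] follows [exp x * (1 - x) <= 1], hence
    [(exp x - 1 - x) * (1 - x) <= x * x], and [1 - x >= 1 / 2]. *)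
Lemma Rabs_exp_sub_le (x : R) : Rabs x <= 1 / 2 -> Rabs (exp x - 1 - x) <= 2 * (x * x).
Proof.
  intros Hx.
  assert (Hx' : - (1 / 2) <= x <= 1 / 2) by (apply Rabs_le_between; assumption).
  generalize (exp_ineq1_le x), (exp_ineq1_le (- x)), (exp_pos x); intros A B P.
  assert (E : exp x * exp (- x) = 1) by (rewrite <- exp_plus, Rplus_opp_r; apply exp_0).
  assert (exp x * (1 - x) <= 1) by (rewrite <- E; apply Rmult_le_compat_l; lra).
  rewrite Rabs_pos_eq by lra.
  assert ((exp x - 1 - x) * (1 - x) <= x * x) by nra.
  nra.
Qed.

(** The real and the imaginary part each split into two pieces of absolute value at most twice the
    square of [Cmod z], which gives 8. *)
Lemma Cmod_cexp_sub_le (z : C) :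
  Cmod z <= 1 / 2 -> Cmod (cexp z - 1 - z)%C <= 8 * (Cmod z * Cmod z).
Proof.
  intros Hz.
  assert (Hx := Rle_trans _ _ _ (re_le_Cmod z) Hz).
  assert (Hy := Rle_trans _ _ _ (im_le_Cmod z) Hz).
  generalize (re_le_Cmod z), (im_le_Cmod z); intros Lx Ly.
  set (m := Cmod z) in *; set (x := Re z) in *; set (y := Im z) in *.
  eapply Rle_trans; [apply Cmod_le_Rabs|].
  replace (Re (cexp z - 1 - z)%C) with (exp x * (cos y - 1) + (exp x - 1 - x))
    by (unfold x, y, cexp, Re, Im; simpl; ring).
  replace (Im (cexp z - 1 - z)%C) with (exp x * (sin y - y) + y * (exp x - 1))
    by (unfold x, y, cexp, Re, Im; simpl; ring).
  generalize (Rabs_exp_sub_le x Hx), (Rabs_cos_sub_1_le y), (Rabs_sin_sub_le y); intros A B D.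
  specialize (D ltac:(lra)).
  assert (Mx : x * x <= m * m).
  { rewrite <- (Rabs_pos_eq (x * x)) by nra. rewrite Rabs_mult.
    apply Rmult_le_compat; try apply Rabs_pos; assumption. }
  assert (My : y * y <= m * m).
  { rewrite <- (Rabs_pos_eq (y * y)) by nra. rewrite Rabs_mult.
    apply Rmult_le_compat; try apply Rabs_pos; assumption. }
  assert (X2 : x * x <= 1 / 2 * Rabs x).
  { rewrite <- (Rabs_pos_eq (x * x)) by nra. rewrite Rabs_mult.
    apply Rmult_le_compat_r; try apply Rabs_pos; assumption. }
  assert (E1 : Rabs (exp x - 1) <= 2 * Rabs x).
  { replace (exp x - 1) with ((exp x - 1 - x) + x) by ring.
    eapply Rle_trans; [apply Rabs_triang|lra]. }
  assert (E2 : Rabs (exp x) <= 2).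
  { replace (exp x) with ((exp x - 1) + 1) by ring.
    eapply Rle_trans; [apply Rabs_triang|]. rewrite Rabs_R1; lra. }
  assert (T1 : Rabs (exp x * (cos y - 1)) <= 2 * (y * y)).
  { rewrite Rabs_mult; apply Rmult_le_compat; try apply Rabs_pos; assumption. }
  assert (T2 : Rabs (exp x * (sin y - y)) <= 2 * (y * y)).
  { rewrite Rabs_mult; apply Rmult_le_compat; try apply Rabs_pos; assumption. }
  assert (T3 : Rabs (y * (exp x - 1)) <= m * (2 * m)).
  { rewrite Rabs_mult; apply Rmult_le_compat; try apply Rabs_pos; lra. }
  generalize (Rabs_triang (exp x * (cos y - 1)) (exp x - 1 - x)),
    (Rabs_triang (exp x * (sin y - y)) (y * (exp x - 1))).
  lra.
Qed.

Lemma hol_cexp_scal_deriv (c s0 : C) :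
  exists r M, 0 < r <= 1 /\
    exists J : jet s0 r (fun s => cexp (c * s)%C) M, proj1_sig J = (c * cexp (c * s0))%C.
Proof.
  generalize (Cmod_ge_0 c); intros Pc.
  (* Chosen so that [Cmod (c * h) <= 1 / 2], the range of [Cmod_cexp_sub_le]. *)
  set (r := / (2 * (Cmod c + 1))).
  assert (Hr : 0 < r) by (apply Rinv_0_lt_compat; lra).
  assert (Hr2 : 2 * (Cmod c + 1) * r = 1) by (unfold r; field; lra).
  assert (Hr1 : r <= 1) by nra.
  exists r, (Cmod (cexp (c * s0)%C) + Cmod (c * cexp (c * s0))%C
    + Cmod (cexp (c * s0)%C) * (8 * (Cmod c * Cmod c))).
  split; [lra|].
  unshelve eexists.
  - exists (c * cexp (c * s0))%C.
    exists (Cmod (cexp (c * s0)%C)), (Cmod (c * cexp (c * s0))%C),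
      (Cmod (cexp (c * s0)%C) * (8 * (Cmod c * Cmod c))).
    repeat split; try lra.
    + intros h Hh.
      replace (cexp (c * (s0 + h)) - cexp (c * s0) - c * cexp (c * s0) * h)%C
        with (cexp (c * s0) * (cexp (c * h) - 1 - c * h))%C
        by (rewrite Cmult_plus_distr_l, cexp_plus; ring).
      rewrite Cmod_mult, !Rmult_assoc.
      apply Rmult_le_compat_l; [apply Cmod_ge_0|].
      eapply Rle_trans; [apply Cmod_cexp_sub_le|].
      * rewrite Cmod_mult; generalize (Cmod_ge_0 h); intros.
        assert (Cmod c * Cmod h <= (Cmod c + 1) * r) by (apply Rmult_le_compat; lra). lra.
      * rewrite Cmod_mult; right; ring.
    + apply Rmult_le_pos; [apply Cmod_ge_0|]. nra.
  - reflexivity.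
Qed.

Lemma hol_cexp_scal (c s0 : C) : hol s0 (fun s => cexp (c * s)%C).
Proof.
  destruct (hol_cexp_scal_deriv c s0) as (r & M & Hr & J & _).
  exists r, M; split; [assumption|constructor; exact J].
Qed.


(** * The complex binomial series *)

(** The Pochhammer quotient [A (A+1) ... (A+k-1) / k!], the coefficient of [x^k] in
    [(1 - x)^(-A)]. *)
Fixpoint rising (A : R) (k : nat) : R :=
  match k with
  | O => 1
  | S j => rising A j * ((A + INR j) / INR (S j))
  end.

Lemma INR_S_pos (k : nat) : 0 < INR (S k).
Proof. apply lt_0_INR; lia. Qed.

Lemma RtoC_neq_0 (x : R) : x <> 0 -> RtoC x <> 0%C.
Proof. intros H E; apply (f_equal Re) in E; simpl in E; lra. Qed.

Lemma rising_pos (A : R) (k : nat) : 0 < A -> 0 < rising A k.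
Proof.
  intros HA; induction k as [|k IH]; simpl rising; [lra|].
  apply Rmult_lt_0_compat; [assumption|].
  apply Rdiv_lt_0_compat; [|apply INR_S_pos].
  generalize (pos_INR k); lra.
Qed.

(** Ratio test: [(A + n) / (n + 1) = 1 + (A - 1) / (n + 1)] tends to 1, so the ratio of consecutive
    terms tends to [x]. *)
Lemma ex_series_rising (A x : R) :
  0 < A -> 0 < x < 1 -> ex_series (fun k => rising A k * x ^ k).
Proof.
  intros HA Hx.
  apply ex_series_ext with (fun k => Rabs (rising A k * x ^ k)).
  { intros k; apply Rabs_pos_eq, Rmult_le_pos; [left; now apply rising_pos|apply pow_le; lra]. }
  apply ex_series_DAlembert with x; [lra|..].
  - intros k; apply Rmult_integral_contrapositive_currified.
    + generalize (rising_pos A k HA); lra.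
    + apply pow_nonzero; lra.
  - assert (L : is_lim_seq (fun n => (1 + (A - 1) * / INR (S n)) * x) ((1 + (A - 1) * 0) * x)).
    { apply is_lim_seq_mult'; [|apply is_lim_seq_const].
      apply is_lim_seq_plus'; [apply is_lim_seq_const|].
      apply is_lim_seq_mult'; [apply is_lim_seq_const|].
      replace (Finite 0) with (Rbar_inv p_infty) by reflexivity.
      apply is_lim_seq_inv; [|easy].
      apply -> is_lim_seq_incr_1; apply is_lim_seq_INR. }
    replace ((1 + (A - 1) * 0) * x) with x in L by ring.
    revert L; apply is_lim_seq_ext; intros n.
    generalize (rising_pos A n HA), (INR_S_pos n), (pow_lt x n (proj1 Hx)), (pos_INR n); intros P1 P2 P3 P4.
    rewrite Rabs_pos_eq.
    + change (rising A (S n)) with (rising A n * ((A + INR n) / INR (S n))).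
      simpl pow; rewrite S_INR in *; field; lra.
    + left; apply Rdiv_lt_0_compat; apply Rmult_lt_0_compat; try assumption;
        [now apply rising_pos|apply pow_lt; lra].
Qed.

Lemma cbinom_S (w : C) (k : nat) :
  cbinom w (S k) = (cbinom w k * ((w - RtoC (INR k)) / RtoC (INR (S k))))%C.
Proof.
  unfold cbinom; simpl cfalling.
  change (fact (S k)) with (S k * fact k)%nat.
  rewrite mult_INR, RtoC_mult.
  field; split; apply RtoC_neq_0; [|apply INR_fact_neq_0].
  generalize (INR_S_pos k); lra.
Qed.

(** Passing from [k] to [k + 1] multiplies by the affine function [- (s + k) / (k + 1)]. Its value
    is bounded by [(Cmod s0 + k) / (k + 1)] and its slope adds [1 / (k + 1)], which is the origin of
    [Cmod s0 + 1]. *)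
Lemma jet_cbinom_opp (s0 : C) (r : R) (k : nat) :
  r <= 1 -> jet s0 r (fun s => cbinom (- s)%C k) (rising (Cmod s0 + 1) k).
Proof.
  intros Hr; induction k as [|k IH].
  - eapply jet_weaken; [apply Rle_refl| |apply (jet_const s0 r (cbinom 0%C 0))].
    unfold cbinom; simpl; rewrite Cmod_div, !Cmod_R, Rabs_R1; [lra|].
    apply RtoC_neq_0; lra.
  - generalize (INR_S_pos k); intros Pk.
    assert (Nk : RtoC (INR (S k)) <> 0%C) by (apply RtoC_neq_0; lra).
    apply jet_ext with (fun s => cbinom (- s)%C k
      * ((- / RtoC (INR (S k))) * s + - (RtoC (INR k) / RtoC (INR (S k)))))%C.
    { intros s; rewrite cbinom_S; field; assumption. }
    change (rising (Cmod s0 + 1) (S k))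
      with (rising (Cmod s0 + 1) k * ((Cmod s0 + 1 + INR k) / INR (S k))).
    apply jet_mult; [assumption..|].
    eapply jet_weaken; [apply Rle_refl| |apply jet_affine].
    replace (- / RtoC (INR (S k)) * s0 + - (RtoC (INR k) / RtoC (INR (S k))))%C
      with (- ((s0 + RtoC (INR k)) / RtoC (INR (S k))))%C by (field; assumption).
    rewrite !Cmod_opp, Cmod_div, Cmod_inv, Cmod_R, (Rabs_pos_eq (INR (S k))) by (assumption || lra).
    replace ((Cmod s0 + 1 + INR k) / INR (S k)) with ((Cmod s0 + INR k) / INR (S k) + / INR (S k))
      by (field; lra).
    apply Rplus_le_compat_r, Rmult_le_compat_r; [left; now apply Rinv_0_lt_compat|].
    eapply Rle_trans; [apply Cmod_triangle|].
    rewrite Cmod_R, Rabs_pos_eq; [lra|apply pos_INR].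
Qed.

Lemma Cmod_cbinom_le (w : C) (k : nat) : Cmod (cbinom w k) <= rising (Cmod w + 1) k.
Proof.
  generalize (jet_value _ _ _ _ (jet_cbinom_opp (- w)%C 1 k (Rle_refl 1))).
  rewrite Cmod_opp; replace (- - w)%C with w by ring; trivial.
Qed.

Lemma CV_radius_cbinom (w : C) (f : C -> R) (t : R) :
  (forall z, Rabs (f z) <= Cmod z) -> Rabs t < 1 ->
  Rbar_lt (Rabs t) (CV_radius (fun k => f (cbinom w k))).
Proof.
  intros Hf Ht; generalize (Rabs_pos t); intros Pt.
  (* A point strictly between [Rabs t] and 1, positive even for [t = 0]. *)
  set (x := (1 + Rabs t) / 2).
  apply Rbar_lt_le_trans with x; [unfold x; simpl; lra|].
  apply Lub_Rbar_correct.
  unfold CV_disk.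
  apply ex_series_Rabs_le with (fun k => rising (Cmod w + 1) k * x ^ k).
  - intros k; rewrite Rabs_Rabsolu, Rabs_mult.
    rewrite (Rabs_pos_eq (x ^ k)) by (apply pow_le; unfold x; lra).
    apply Rmult_le_compat_r; [apply pow_le; unfold x; lra|].
    eapply Rle_trans; [apply Hf|apply Cmod_cbinom_le].
  - apply ex_series_rising; [generalize (Cmod_ge_0 w); lra|unfold x; lra].
Qed.

(** One real component of [(1 + t) f' = w f], the differential equation encoded by
    [(k + 1) c_(k+1) = (w - k) c_k]. It is used with [a], [b] the real and imaginary parts of the
    coefficients, then with their roles exchanged and the sign of [v] reversed. *)
Lemma PSeries_binomial_ode (a b : nat -> R) (u v t : R) :
  Rbar_lt (Rabs t) (CV_radius a) -> Rbar_lt (Rabs t) (CV_radius b) ->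
  (forall k, INR (S k) * a (S k) = u * a k + v * b k - INR k * a k) ->
  (1 + t) * PSeries (PS_derive a) t = u * PSeries a t + v * PSeries b t.
Proof.
  intros Ha Hb Hrec.
  assert (Ea := CV_radius_inside _ _ Ha).
  assert (Eb := CV_radius_inside _ _ Hb).
  assert (Ed := ex_pseries_derive _ _ Ha).
  assert (E1 : ex_pseries (PS_plus (PS_scal u a) (PS_scal v b)) t).
  { apply ex_pseries_plus; apply ex_pseries_scal; try assumption; apply Rmult_comm. }
  assert (E2 : ex_pseries (PS_scal (-1) (PS_incr_1 (PS_derive a))) t).
  { apply ex_pseries_scal; [apply Rmult_comm|]. now apply ex_pseries_incr_1. }
  assert (D : PSeries (PS_derive a) t
    = PSeries (PS_plus (PS_plus (PS_scal u a) (PS_scal v b))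
        (PS_scal (-1) (PS_incr_1 (PS_derive a)))) t).
  { apply PSeries_ext; intros k.
    unfold PS_derive at 1; rewrite Hrec.
    unfold PS_plus, PS_scal, PS_incr_1, PS_derive, plus, scal, zero; simpl; unfold mult; simpl.
    destruct k; simpl; ring. }
  rewrite PSeries_plus in D by assumption.
  rewrite PSeries_plus in D by (apply ex_pseries_scal; try assumption; apply Rmult_comm).
  rewrite !PSeries_scal, PSeries_incr_1 in D.
  lra.
Qed.

Lemma eq_of_zero_derive (g : R -> R) (t : R) :
  Rabs t < 1 -> (forall x, Rabs x < 1 -> is_derive g x 0) -> g t = g 0.
Proof.
  intros Ht Hg; apply Rabs_def2 in Ht.
  destruct (Rtotal_order t 0) as [L|[->|L]]; [|reflexivity|symmetry];
    (apply (eq_is_derive g); [|assumption]); intros x Hx; apply Hg, Rabs_def1; lra.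
Qed.

Lemma PSeries_cbinom (w : C) (t : R) :
  Rabs t < 1 ->
  (PSeries (fun k => Re (cbinom w k)) t, PSeries (fun k => Im (cbinom w k)) t)
  = cpow (1 + t) w.
Proof.
  intros Ht.
  set (a := fun k => Re (cbinom w k)); set (b := fun k => Im (cbinom w k)).
  set (u := Re w); set (v := Im w).
  assert (Ra : forall x, Rabs x < 1 -> Rbar_lt (Rabs x) (CV_radius a)).
  { intros x; apply (CV_radius_cbinom w Re), re_le_Cmod. }
  assert (Rb : forall x, Rabs x < 1 -> Rbar_lt (Rabs x) (CV_radius b)).
  { intros x; apply (CV_radius_cbinom w Im), im_le_Cmod. }
  assert (Rec : forall k, (RtoC (INR (S k)) * cbinom w (S k) = (w - RtoC (INR k)) * cbinom w k)%C).
  { intros k; rewrite cbinom_S; field; apply RtoC_neq_0; generalize (INR_S_pos k); lra. }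
  assert (Reca : forall k, INR (S k) * a (S k) = u * a k + - v * b k - INR k * a k).
  { intros k; generalize (f_equal Re (Rec k)); unfold a, b, u, v, Re, Im; cbn -[INR cbinom]; lra. }
  assert (Recb : forall k, INR (S k) * b (S k) = u * b k + v * a k - INR k * b k).
  { intros k; generalize (f_equal Im (Rec k)); unfold a, b, u, v, Re, Im; cbn -[INR cbinom]; lra. }
  set (P := PSeries a); set (Q := PSeries b).
  assert (DP : forall x, Rabs x < 1 -> is_derive P x ((u * P x - v * Q x) / (1 + x))).
  { intros x Hx; assert (1 + x <> 0) by (apply Rabs_def2 in Hx; lra).
    replace ((u * P x - v * Q x) / (1 + x)) with (PSeries (PS_derive a) x).
    - now apply is_derive_PSeries, Ra.
    - apply Rmult_eq_reg_l with (1 + x); [|assumption].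
      rewrite (PSeries_binomial_ode a b u (- v)) by auto. fold P Q; field; assumption. }
  assert (DQ : forall x, Rabs x < 1 -> is_derive Q x ((u * Q x + v * P x) / (1 + x))).
  { intros x Hx; assert (1 + x <> 0) by (apply Rabs_def2 in Hx; lra).
    replace ((u * Q x + v * P x) / (1 + x)) with (PSeries (PS_derive b) x).
    - now apply is_derive_PSeries, Rb.
    - apply Rmult_eq_reg_l with (1 + x); [|assumption].
      rewrite (PSeries_binomial_ode b a u v) by auto. fold P Q; field; assumption. }
  assert (P0 : P 0 = 1).
  { unfold P; rewrite PSeries_0; unfold a, cbinom; simpl; field. }
  assert (Q0 : Q 0 = 0).
  { unfold Q; rewrite PSeries_0; unfold b, cbinom; simpl; field. }
  (* From here on only the differential equations and the values at 0 matter, not that [P] and [Q]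
     are power series. *)
  clearbody P Q.
  assert (L0 : ln (1 + 0) = 0) by (rewrite Rplus_0_r; apply ln_1).
  set (L := ln (1 + t)).
  (* Both components of [(P + iQ)(t) (1 + t)^(-w)] are constant. *)
  assert (G1 : exp (- u * L) * (P t * cos (v * L) + Q t * sin (v * L)) = 1).
  { transitivity (exp (- u * ln (1 + 0)) *
      (P 0 * cos (v * ln (1 + 0)) + Q 0 * sin (v * ln (1 + 0)))).
    - apply (eq_of_zero_derive (fun x => exp (- u * ln (1 + x)) *
        (P x * cos (v * ln (1 + x)) + Q x * sin (v * ln (1 + x))))); [assumption|].
      intros x Hx; assert (0 < 1 + x) by (apply Rabs_def2 in Hx; lra).
      assert (DPx := DP x Hx); assert (DQx := DQ x Hx).
      auto_derive; [repeat split; try lra; eexists; eassumption|].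
      replace (Derive (fun x0 : R => P x0) x) with ((u * P x - v * Q x) / (1 + x))
        by (symmetry; now apply is_derive_unique).
      replace (Derive (fun x0 : R => Q x0) x) with ((u * Q x + v * P x) / (1 + x))
        by (symmetry; now apply is_derive_unique).
      field; lra.
    - rewrite L0, P0, Q0, !Rmult_0_r, exp_0, cos_0; ring. }
  assert (G2 : exp (- u * L) * (Q t * cos (v * L) - P t * sin (v * L)) = 0).
  { transitivity (exp (- u * ln (1 + 0)) *
      (Q 0 * cos (v * ln (1 + 0)) - P 0 * sin (v * ln (1 + 0)))).
    - apply (eq_of_zero_derive (fun x => exp (- u * ln (1 + x)) *
        (Q x * cos (v * ln (1 + x)) - P x * sin (v * ln (1 + x))))); [assumption|].
      intros x Hx; assert (0 < 1 + x) by (apply Rabs_def2 in Hx; lra).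
      assert (DPx := DP x Hx); assert (DQx := DQ x Hx).
      auto_derive; [repeat split; try lra; eexists; eassumption|].
      replace (Derive (fun x0 : R => P x0) x) with ((u * P x - v * Q x) / (1 + x))
        by (symmetry; now apply is_derive_unique).
      replace (Derive (fun x0 : R => Q x0) x) with ((u * Q x + v * P x) / (1 + x))
        by (symmetry; now apply is_derive_unique).
      field; lra.
    - rewrite L0, P0, Q0, !Rmult_0_r, exp_0, sin_0; ring. }
  assert (E : exp (u * L) * exp (- u * L) = 1).
  { rewrite <- exp_plus; replace (u * L + - u * L) with 0 by ring; apply exp_0. }
  assert (T := sin2_cos2 (v * L)); unfold Rsqr in T.
  unfold cpow, cexp.
  replace (Re (w * RtoC (ln (1 + t)))%C) with (u * L) by (unfold u, L, Re; simpl; ring).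
  replace (Im (w * RtoC (ln (1 + t)))%C) with (v * L) by (unfold v, L, Im; simpl; ring).
  set (e := exp (u * L)) in *; set (e' := exp (- u * L)) in *.
  set (c := cos (v * L)) in *; set (s := sin (v * L)) in *.
  apply injective_projections; simpl.
  (* [G1] and [G2] give [(P + iQ)(t)] scaled by [e'] and rotated by [- v * L]; scaling by [e] and
     rotating back recovers it. *)
  - transitivity (e * (e' * (P t * c + Q t * s)) * c - e * (e' * (Q t * c - P t * s)) * s).
    + transitivity (e * e' * (P t * (s * s + c * c))); [rewrite E, T; ring|ring].
    + rewrite G1, G2; ring.
  - transitivity (e * (e' * (P t * c + Q t * s)) * s + e * (e' * (Q t * c - P t * s)) * c).
    + transitivity (e * e' * (Q t * (s * s + c * c))); [rewrite E, T; ring|ring].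
    + rewrite G1, G2; ring.
Qed.

Lemma CSeries_binomial (w : C) (t : R) :
  Rabs t < 1 -> CSeries (fun k => cbinom w k * RtoC (t ^ k))%C = cpow (1 + t) w.
Proof.
  intros Ht; rewrite <- PSeries_cbinom by assumption.
  apply injective_projections; apply Series_ext; intros k; unfold Re, Im; simpl; ring.
Qed.


(** * The common shape of both series *)

Definition vexp (a : R) (k : nat) (s : C) : C := cexp (- RtoC a * (s + RtoC (2 * INR k)))%C.

(** With [a = ln eps], the odd series is the case [sg = 1], [e = 1] and the even series the case
    [sg = -1], [e = 2]. *)
Definition zterm (a sg : R) (e k : nat) (s : C) : C :=
  (cbinom (- s) k * RtoC (sg ^ k) * Cpow (vexp a k s) e
     * / (1 - vexp a k s * vexp a k s))%C.

Lemma exp_mult_INR (x : R) (n : nat) : exp (INR n * x) = exp x ^ n.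
Proof.
  induction n as [|n IH]; [simpl; rewrite Rmult_0_l; apply exp_0|].
  rewrite S_INR, Rmult_plus_distr_r, exp_plus, IH, Rmult_1_l; simpl; ring.
Qed.

(** The index enters only through a constant factor, so a single jet of [cexp (- a * s)] bounds all
    [vexp a k] at once, with geometric decay in [k]. *)
Lemma vexp_split (a : R) (k : nat) (s : C) :
  vexp a k s = (RtoC (exp (-2 * a) ^ k) * cexp (- RtoC a * s))%C.
Proof.
  rewrite <- exp_mult_INR, <- cexp_RtoC, <- cexp_plus; unfold vexp; f_equal.
  apply injective_projections; simpl; ring.
Qed.

Lemma Cmod_vexp (a : R) (k : nat) (s : C) :
  Cmod (vexp a k s) = exp (- a * (Re s + 2 * INR k)).
Proof. unfold vexp; rewrite Cmod_cexp; f_equal; unfold Re; simpl; ring. Qed.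

Lemma exp_neg_bounds (a : R) : 0 < a -> 0 < exp (-2 * a) < 1.
Proof.
  intros Ha; split; [apply exp_pos|].
  rewrite <- exp_0; apply exp_increasing; lra.
Qed.

Lemma jet_pow (s0 : C) (r : R) (f : C -> C) (M : R) (n : nat) :
  r <= 1 -> jet s0 r f M -> jet s0 r (fun s => Cpow (f s) n) (M ^ n).
Proof.
  intros Hr J; induction n as [|n IH]; simpl.
  - eapply jet_weaken; [apply Rle_refl| |apply jet_const].
    rewrite Cmod_R, Rabs_R1; lra.
  - now apply jet_mult.
Qed.

(** From [K] on, [vexp] has modulus at most [1 / 2] on the disc, so the denominators stay away from
    0. As [0 < e], the numerator keeps a factor [rho ^ n], which beats the polynomial growth of
    [rising]. *)
Lemma zterm_jets (a sg : R) (e : nat) (s0 : C) :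
  0 < a -> Rabs sg = 1 -> (0 < e)%nat ->
  exists (K : nat) (r : R) (M : nat -> R), 0 < r <= 1 /\
    inhabited (forall k, jet s0 r (zterm a sg e (K + k)) (M k)) /\ ex_series M.
Proof.
  intros Ha Hsg He.
  destruct (hol_cexp_scal (- RtoC a)%C s0) as (r & M0 & Hr & [J0]).
  assert (P0 := jet_pos _ _ _ _ J0).
  destruct (exp_neg_bounds a Ha) as [R0 R1]; set (rho := exp (-2 * a)) in *.
  assert (HK : exists K, rho ^ K * M0 <= 1 / 2).
  { destruct (pow_lt_1_zero rho) with (y := / (2 * (M0 + 1))) as [K HK].
    - rewrite Rabs_pos_eq; lra.
    - apply Rinv_0_lt_compat; lra.
    - exists K; specialize (HK K (Nat.le_refl K)).
      assert (Pk := pow_lt rho K R0); rewrite Rabs_pos_eq in HK by lra.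
      apply Rle_trans with (/ (2 * (M0 + 1)) * (M0 + 1)).
      + apply Rmult_le_compat; lra.
      + right; field; lra. }
  destruct HK as [K HK].
  assert (HKk : forall k, rho ^ (K + k) * M0 <= 1 / 2).
  { intros k; eapply Rle_trans; [|exact HK].
    apply Rmult_le_compat_r; [assumption|].
    rewrite pow_add; apply Rle_trans with (rho ^ K * 1); [|lra].
    apply Rmult_le_compat_l; [apply pow_le; lra|].
    rewrite <- (pow1 k); apply pow_incr; lra. }
  set (A := Cmod s0 + 1).
  assert (PA : 0 < A) by (unfold A; generalize (Cmod_ge_0 s0); lra).
  exists K, r, (fun k => rising A (K + k) * rho ^ (K + k) * (M0 * 50)).
  split; [assumption|]; split.
  - constructor; intros k; specialize (HKk k).
    set (n := (K + k)%nat) in *.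
    assert (Pn : 0 < rho ^ n) by now apply pow_lt.
    assert (PM : 0 <= rho ^ n * M0) by (apply Rmult_le_pos; lra).
    assert (Jv : jet s0 r (vexp a n) (rho ^ n * M0)).
    { apply jet_ext with (fun s => RtoC (rho ^ n) * cexp (- RtoC a * s))%C.
      { intros s; now rewrite vexp_split. }
      apply jet_mult; [lra| |assumption].
      eapply jet_weaken; [apply Rle_refl| |apply jet_const].
      rewrite Cmod_R, Rabs_pos_eq; lra. }
    assert (Jd : jet s0 r (fun s => 1 - vexp a n s * vexp a n s)%C 2).
    { apply jet_ext with (fun s => 1 + (- (1)) * (vexp a n s * vexp a n s))%C.
      { intros s; ring. }
      eapply jet_weaken; [apply Rle_refl| |
        apply jet_plus; [apply jet_const|apply jet_mult; [lra|apply jet_const|apply jet_mult; [lra|exact Jv..]]]].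
      rewrite Cmod_opp, Cmod_R, Rabs_R1. nra. }
    (* [jet_inv] with bound 2 and [delta = 1 / 2] gives [2 + 16 + 32]. *)
    assert (Ji : jet s0 r (fun s => / (1 - vexp a n s * vexp a n s))%C 50).
    { eapply jet_weaken; [apply Rle_refl| |
        apply (jet_inv s0 r (fun s => 1 - vexp a n s * vexp a n s)%C 2 (1 / 2))]; try lra.
      - intros h Hh.
        assert (B := jet_bound s0 r _ _ h (proj2 Hr) Jv Hh).
        generalize (Cmod_sub_ge 1%C (- (vexp a n (s0 + h)%C * vexp a n (s0 + h)%C))%C).
        rewrite Cmod_opp, Cmod_mult, Cmod_R, Rabs_R1.
        change (1 + - (vexp a n (s0 + h) * vexp a n (s0 + h)))%C
          with (1 - vexp a n (s0 + h) * vexp a n (s0 + h))%C.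
        generalize (Cmod_ge_0 (vexp a n (s0 + h)%C)); intros.
        assert (Cmod (vexp a n (s0 + h)%C) * Cmod (vexp a n (s0 + h)%C) <= 1 / 2 * (1 / 2))
          by (apply Rmult_le_compat; lra).
        lra.
      - exact Jd. }
    apply jet_weaken with (r := r) (M := rising A n * 1 * (rho ^ n * M0) ^ e * 50).
    + lra.
    + assert (Hp : (rho ^ n * M0) ^ e <= rho ^ n * M0).
      { destruct e as [|e]; [lia|]; simpl pow.
        rewrite <- (Rmult_1_r (rho ^ n * M0)) at 3.
        apply Rmult_le_compat_l; [assumption|].
        rewrite <- (pow1 e); apply pow_incr; lra. }
      generalize (rising_pos A n PA); intros Pr.
      apply Rle_trans with (rising A n * (rho ^ n * M0) * 50); [|right; ring].
      rewrite Rmult_1_r; apply Rmult_le_compat_r; [lra|].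
      apply Rmult_le_compat_l; lra.
    + apply (jet_mult s0 r (fun s => cbinom (- s) n * RtoC (sg ^ n) * Cpow (vexp a n s) e)%C);
        [lra| |exact Ji].
      apply (jet_mult s0 r (fun s => cbinom (- s) n * RtoC (sg ^ n))%C);
        [lra| |apply jet_pow; [lra|exact Jv]].
      apply jet_mult; [lra|apply jet_cbinom_opp; lra|].
      eapply jet_weaken; [apply Rle_refl| |apply jet_const].
      rewrite Cmod_R, <- RPow_abs, Hsg, pow1; lra.
  - apply ex_series_scal_r.
    apply (ex_series_incr_n (fun n => rising A n * rho ^ n)).
    apply ex_series_rising; [assumption|lra].
Qed.

Lemma ex_series_Cmod_zterm (a sg : R) (e : nat) (s : C) :
  0 < a -> Rabs sg = 1 -> (0 < e)%nat -> ex_series (fun k => Cmod (zterm a sg e k s)).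
Proof.
  intros Ha Hsg He.
  destruct (zterm_jets a sg e s Ha Hsg He) as (K & r & M & Hr & [J] & HM).
  apply (ex_series_incr_n _ K).
  apply ex_series_Cmod_le with (a := fun k => zterm a sg e (K + k) s) (b := M); [|assumption].
  intros k; now apply jet_value with r.
Qed.

Lemma hol_cbinom_opp (s0 : C) (k : nat) : hol s0 (fun s => cbinom (- s)%C k).
Proof.
  exists 1, (rising (Cmod s0 + 1) k); split; [lra|constructor; apply jet_cbinom_opp; lra].
Qed.

Lemma hol_vexp (a : R) (k : nat) (s0 : C) : hol s0 (vexp a k).
Proof.
  apply hol_ext with (fun s => RtoC (exp (-2 * a) ^ k) * cexp (- RtoC a * s))%C.
  - intros s; now rewrite vexp_split.
  - apply hol_mult; [apply hol_const|apply hol_cexp_scal].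
Qed.

Lemma hol_zterm_numerator (a sg : R) (e k : nat) (s0 : C) :
  hol s0 (fun s => cbinom (- s) k * RtoC (sg ^ k) * Cpow (vexp a k s) e)%C.
Proof.
  apply (hol_mult s0 (fun s => cbinom (- s) k * RtoC (sg ^ k))%C).
  - apply hol_mult; [apply hol_cbinom_opp|apply hol_const].
  - apply hol_pow, hol_vexp.
Qed.

Lemma hol_zterm (a sg : R) (e k : nat) (s0 : C) :
  (vexp a k s0 * vexp a k s0)%C <> 1%C -> hol s0 (zterm a sg e k).
Proof.
  intros H; apply hol_mult; [apply hol_zterm_numerator|].
  apply hol_inv.
  - intros E; apply H.
    replace (vexp a k s0 * vexp a k s0)%C
      with (1 - (1 - vexp a k s0 * vexp a k s0))%C by ring.
    rewrite E; ring.
  - apply hol_ext with (fun s => 1 + (- (1)) * (vexp a k s * vexp a k s))%C.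
    { intros s; ring. }
    apply hol_plus; [apply hol_const|].
    apply hol_mult; [apply hol_const|apply hol_mult; apply hol_vexp].
Qed.

(** The mask covers both uses: all terms at a regular point, and all terms except the singular one
    at a pole. *)
Lemma hol_masked_zterm_series (a sg : R) (e : nat) (b : nat -> bool) (s0 : C) :
  0 < a -> Rabs sg = 1 -> (0 < e)%nat ->
  (forall k, b k = true -> (vexp a k s0 * vexp a k s0)%C <> 1%C) ->
  hol s0 (fun s => CSeries (fun k => if b k then zterm a sg e k s else 0%C)).
Proof.
  intros Ha Hsg He Hb.
  destruct (zterm_jets a sg e s0 Ha Hsg He) as (K & r & M & Hr & [J] & HM).
  apply (hol_CSeries (fun k s => if b k then zterm a sg e k s else 0%C) s0 K r M); try assumption.
  - intros s; eapply ex_series_Cmod_le; [|exact (ex_series_Cmod_zterm a sg e s Ha Hsg He)].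
    intros k; destruct (b k); [apply Rle_refl|rewrite Cmod_0; apply Cmod_ge_0].
  - intros k _; destruct (b k) eqn:E; [apply hol_zterm; auto|apply hol_const].
  - intros k; destruct (b (K + k)%nat); [apply J|].
    eapply jet_weaken; [apply Rle_refl| |apply jet_const].
    rewrite Cmod_0; exact (jet_pos _ _ _ _ (J k)).
Qed.

(** * Location and simplicity of the poles *)

(** If [vexp] had nonzero imaginary part, its real part would vanish and its square would be
    negative. So it is real of modulus 1: the modulus fixes [Re s], and the zeros of the sine give
    the integer [m]. *)
Lemma vexp_sqr_eq_1 (a : R) (k : nat) (s : C) :
  0 < a ->
  ((vexp a k s * vexp a k s)%C = 1%C <->
   exists m : Z, s = (- 2 * INR k, PI * IZR m / a)).
Proof.
  intros Ha; destruct s as [x t].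
  set (E := exp (- a * (x + 2 * INR k))).
  assert (V : vexp a k (x, t) = (E * cos (a * t), - (E * sin (a * t)))).
  { unfold vexp, cexp.
    replace (Re (- RtoC a * ((x, t) + RtoC (2 * INR k)))%C) with (- a * (x + 2 * INR k))
      by (unfold Re; simpl; ring).
    replace (Im (- RtoC a * ((x, t) + RtoC (2 * INR k)))%C) with (- (a * t))
      by (unfold Im; simpl; ring).
    rewrite cos_neg, sin_neg; fold E; f_equal; ring. }
  assert (PE : 0 < E) by apply exp_pos.
  assert (T := sin2_cos2 (a * t)); unfold Rsqr in T.
  rewrite V; split.
  - intros H.
    assert (H1 := f_equal Re H); assert (H2 := f_equal Im H).
    unfold Re, Im in H1, H2; simpl in H1, H2.
    set (c := cos (a * t)) in *; set (d := sin (a * t)) in *.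
    assert (d = 0).
    { destruct (Req_dec d 0) as [|N]; [assumption|exfalso].
      assert (c = 0).
      { apply Rmult_eq_reg_l with (2 * E * E * d); [nra|].
        repeat apply Rmult_integral_contrapositive_currified; lra. }
      nra. }
    assert (E1 : E = 1) by nra.
    assert (X : - a * (x + 2 * INR k) = 0).
    { apply exp_inv; rewrite exp_0; exact E1. }
    destruct (sin_eq_0_0 (a * t)) as [m Hm]; [assumption|].
    exists m; f_equal.
    + nra.
    + apply Rmult_eq_reg_l with a; [|lra]. rewrite Hm; field; lra.
  - intros [m Hm].
    assert (Hx := f_equal fst Hm); assert (Ht := f_equal snd Hm); simpl in Hx, Ht.
    assert (E1 : E = 1).
    { unfold E; rewrite Hx, <- exp_0; f_equal; ring. }
    assert (S0 : sin (a * t) = 0).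
    { apply sin_eq_0_1; exists m; rewrite Ht; field; lra. }
    rewrite S0 in *; rewrite E1.
    apply injective_projections; simpl; lra.
Qed.

(** Used at [z = - s0] with [Re z = 2 * INR k], which exceeds every [j < k]. So the residue survives
    even at the real poles, where [z] is a natural number. *)
Lemma cfalling_neq_0 (z : C) (k : nat) :
  (forall j, (j < k)%nat -> Re z <> INR j) -> cfalling z k <> 0%C.
Proof.
  induction k as [|k IH]; intros H; simpl.
  - apply RtoC_neq_0; lra.
  - apply Cmult_neq_0; [apply IH; auto|].
    intros E; apply (H k); [lia|].
    apply (f_equal Re) in E; unfold Re in *; simpl in E; lra.
Qed.

Lemma RtoC_inv_neq_0 (x : R) : x <> 0 -> (/ RtoC x)%C <> 0%C.
Proof. intros H; rewrite <- RtoC_inv by assumption; now apply RtoC_neq_0, Rinv_neq_0_compat. Qed.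

Lemma CSeries_isolate (a : nat -> C) (k0 : nat) :
  ex_series (fun k => Cmod (a k)) ->
  CSeries a = (a k0 + CSeries (fun k => if negb (k =? k0)%nat then a k else 0))%C.
Proof.
  revert a; induction k0 as [|k0 IH]; intros a Ha.
  - rewrite (CSeries_incr_1 a Ha), (CSeries_incr_1 (fun k => if negb (k =? 0)%nat then a k else 0%C)).
    + simpl; ring.
    + eapply ex_series_Cmod_le; [|exact Ha]; intros k.
      destruct (negb (k =? 0)%nat); [apply Rle_refl|rewrite Cmod_0; apply Cmod_ge_0].
  - rewrite (CSeries_incr_1 a Ha), (CSeries_incr_1 (fun k => if negb (k =? S k0)%nat then a k else 0%C)).
    + rewrite (IH (fun k => a (S k))) by now apply (ex_series_incr_1 (fun k => Cmod (a k))).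
      simpl; ring.
    + eapply ex_series_Cmod_le; [|exact Ha]; intros k.
      destruct (negb (k =? S k0)%nat); [apply Rle_refl|rewrite Cmod_0; apply Cmod_ge_0].
Qed.

(** The real part of [s0] determines [k0], so the sum of the other terms is holomorphic at [s0] and
    the residue comes from one term alone. *)
Lemma zterm_series_simple_pole (a sg : R) (e : nat) (p : C -> C) (s0 : C) :
  0 < a -> Rabs sg = 1 -> (0 < e)%nat -> hol s0 p -> p s0 <> 0%C ->
  (exists (k : nat) (m : Z), s0 = (- 2 * INR k, PI * IZR m / a)) ->
  simple_pole (fun s => p s * CSeries (fun k => zterm a sg e k s))%C s0.
Proof.
  intros Ha Hsg He Hp Np (k0 & m & Hs0).
  assert (V1 : (vexp a k0 s0 * vexp a k0 s0)%C = 1%C)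
    by (apply vexp_sqr_eq_1; [assumption|now exists m]).
  set (num := fun s => (cbinom (- s) k0 * RtoC (sg ^ k0) * Cpow (vexp a k0 s) e)%C).
  set (G := fun s => CSeries (fun k => if negb (k =? k0)%nat then zterm a sg e k s else 0%C)).
  assert (HG : hol s0 G).
  { apply hol_masked_zterm_series; try assumption.
    intros k Hk V; apply vexp_sqr_eq_1 in V; [|assumption].
    destruct V as [m' Hm']; rewrite Hs0 in Hm'; apply (f_equal fst) in Hm'; simpl in Hm'.
    assert (k0 = k) by (apply INR_eq; lra); subst k.
    now rewrite Nat.eqb_refl in Hk. }
  assert (Split : forall s, CSeries (fun k => zterm a sg e k s) = (zterm a sg e k0 s + G s)%C).
  { intros s; apply (CSeries_isolate (fun k => zterm a sg e k s)), ex_series_Cmod_zterm; assumption. }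
  set (c := (- RtoC (2 * a))%C).
  destruct (hol_cexp_scal_deriv c s0) as (r & M & Hr & J & HJ).
  assert (Sl : limC s0 (fun s => (cexp (c * s) - cexp (c * s0)) / (s - s0))%C (c * cexp (c * s0))%C).
  { rewrite <- HJ; exact (limC_slope s0 _ r M J (proj1 Hr)). }
  set (kappa := RtoC (exp (-4 * a * INR k0))).
  assert (Hv : forall s, (vexp a k0 s * vexp a k0 s)%C = (kappa * cexp (c * s))%C).
  { intros s; unfold kappa, vexp; rewrite <- cexp_RtoC, <- !cexp_plus; f_equal.
    unfold c; apply injective_projections; simpl; ring. }
  assert (Hk1 : (kappa * cexp (c * s0))%C = 1%C) by (rewrite <- Hv; exact V1).
  (* As the denominator vanishes at [s0], this is the reciprocal of a difference quotient with limit
     [- kappa * c * cexp (c * s0) = - c = 2 * a]. *)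
  assert (L1 : limC s0 (fun s => (s - s0) * / (1 - vexp a k0 s * vexp a k0 s))%C (/ RtoC (2 * a))%C).
  { apply limC_ext with (fun s => / (- kappa * ((cexp (c * s) - cexp (c * s0)) / (s - s0))))%C.
    - intros s Hs.
      assert (Hn : (s - s0)%C <> 0%C).
      { intros E; apply Hs; replace s with ((s - s0) + s0)%C by ring; rewrite E; ring. }
      replace (1 - vexp a k0 s * vexp a k0 s)%C
        with (- kappa * (cexp (c * s) - cexp (c * s0)))%C by (rewrite Hv, <- Hk1; ring).
      set (w := (- kappa * (cexp (c * s) - cexp (c * s0)))%C).
      replace (- kappa * ((cexp (c * s) - cexp (c * s0)) / (s - s0)))%C with (w * / (s - s0))%C
        by (unfold w; field; assumption).
      (* [w] also vanishes at the other poles of this term; there both sides are 0 by the default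
         value of the inverse. *)
      destruct (Ceq_dec w 0%C) as [->|Hw].
      + rewrite Cmult_0_l; apply injective_projections; simpl; unfold Rdiv; ring.
      + field; split; assumption.
    - apply limC_inv; [apply RtoC_neq_0; lra|].
      replace (RtoC (2 * a)) with (- kappa * (c * cexp (c * s0)))%C.
      + apply limC_mult; [apply (limC_hol s0 (fun _ => (- kappa)%C)), hol_const|exact Sl].
      + replace (- kappa * (c * cexp (c * s0)))%C with (- c * (kappa * cexp (c * s0)))%C by ring.
        rewrite Hk1; unfold c; ring. }
  (* The vanishing summand is kept so that the witness matches the limit of the sum literally. *)
  exists (p s0 * (num s0 * / RtoC (2 * a) + (s0 - s0) * G s0))%C; split.
  - apply Cmult_neq_0; [assumption|].
    replace (num s0 * / RtoC (2 * a) + (s0 - s0) * G s0)%C with (num s0 * / RtoC (2 * a))%C by ring.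
    apply Cmult_neq_0.
    + unfold num, cbinom; apply Cmult_neq_0; [apply Cmult_neq_0; [apply Cmult_neq_0|]|].
      * apply cfalling_neq_0; intros j Hj; apply lt_INR in Hj.
        rewrite Hs0; unfold Re; simpl; generalize (pos_INR j); lra.
      * apply RtoC_inv_neq_0, INR_fact_neq_0.
      * apply RtoC_neq_0, pow_nonzero; intros ->; rewrite Rabs_R0 in Hsg; lra.
      * apply Cpow_nz, cexp_neq_0.
    + apply RtoC_inv_neq_0; lra.
  - apply limC_filterlim.
    apply limC_ext with (fun s => p s *
      (num s * ((s - s0) * / (1 - vexp a k0 s * vexp a k0 s)) + (s - s0) * G s))%C.
    + intros s _; rewrite Split; unfold zterm; fold (num s); ring.
    + apply limC_mult; [now apply limC_hol|].
      apply limC_plus.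
      * apply limC_mult; [apply limC_hol, hol_zterm_numerator|exact L1].
      * apply (limC_hol s0 (fun s => (s - s0) * G s)%C).
        apply hol_mult; [|assumption].
        apply hol_ext with (fun s => 1 * s + - s0)%C; [intros s; ring|apply hol_affine].
Qed.


(** * Agreement with the Dirichlet series *)

Lemma Cpow_RtoC (x : R) (n : nat) : Cpow (RtoC x) n = RtoC (x ^ n).
Proof. induction n as [|n IH]; simpl; [reflexivity|now rewrite IH, RtoC_mult]. Qed.

Lemma Cmod_Cpow (z : C) (n : nat) : Cmod (Cpow z n) = Cmod z ^ n.
Proof.
  induction n as [|n IH]; simpl; [rewrite Cmod_R; apply Rabs_R1|now rewrite Cmod_mult, IH].
Qed.

Lemma ex_series_Cmod_binomial (w : C) (t : R) :
  0 < Rabs t < 1 -> ex_series (fun k => Cmod (cbinom w k * RtoC (t ^ k))%C).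
Proof.
  intros Ht.
  apply ex_series_Cmod_le with (fun k => rising (Cmod w + 1) k * Rabs t ^ k).
  - intros k; rewrite Cmod_mult, Cmod_R, RPow_abs.
    apply Rmult_le_compat_r; [apply Rabs_pos|apply Cmod_cbinom_le].
  - apply ex_series_rising; [generalize (Cmod_ge_0 w); lra|assumption].
Qed.

(* The differences [T j - T (j+1)] of [T j = CSeries (zterm * vexp^(2j))] are binomial
   series, so the sum over [j] telescopes and no interchange of summations is needed. *)
Lemma is_series_zterm (a sg : R) (e : nat) (s : C) :
  0 < a -> Rabs sg = 1 -> (0 < e)%nat -> 0 < Re s ->
  is_series (fun j => Cpow (vexp a 0 s) (2 * j + e)
                        * cpow (1 + sg * exp (-2 * a) ^ (2 * j + e)) (- s))%C
    (CSeries (fun k => zterm a sg e k s)).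
Proof.
  intros Ha Hsg He Hs.
  destruct (exp_neg_bounds a Ha) as [R0 R1]; set (rho := exp (-2 * a)) in *.
  set (P := fun k => (vexp a k s * vexp a k s)%C).
  (* The modulus of [vexp a 0 s], the largest of all; [0 < Re s] puts it below 1, so [T j] tends to
     0 geometrically. *)
  set (th := exp (- a * Re s)).
  assert (th0 : 0 < th) by apply exp_pos.
  assert (th1 : th < 1).
  { unfold th; rewrite <- exp_0; apply exp_increasing; nra. }
  assert (Hv : forall k, Cmod (vexp a k s) <= th).
  { intros k; rewrite Cmod_vexp; unfold th.
    assert (Q := pos_INR k).
    destruct (Rle_lt_or_eq_dec (- a * (Re s + 2 * INR k)) (- a * Re s)) as [L|E].
    - nra.
    - left; now apply exp_increasing.
    - rewrite E; apply Rle_refl. }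
  assert (HP : forall k, Cmod (P k) <= th).
  { intros k; unfold P; rewrite Cmod_mult.
    generalize (Hv k), (Cmod_ge_0 (vexp a k s)); nra. }
  assert (P1 : forall k, (1 - P k)%C <> 0%C).
  { intros k E; assert (P k = 1%C).
    { replace (P k) with (1 - (1 - P k))%C by ring; rewrite E; ring. }
    generalize (HP k); rewrite H, Cmod_R, Rabs_R1; lra. }
  assert (AC := ex_series_Cmod_zterm a sg e s Ha Hsg He).
  set (T := fun j => CSeries (fun k => zterm a sg e k s * Cpow (P k) j)%C).
  assert (HT : forall j k, Cmod (zterm a sg e k s * Cpow (P k) j)%C
                <= Cmod (zterm a sg e k s) * th ^ j).
  { intros j k; rewrite Cmod_mult, Cmod_Cpow.
    apply Rmult_le_compat_l; [apply Cmod_ge_0|].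
    apply pow_incr; split; [apply Cmod_ge_0|apply HP]. }
  assert (AT : forall j, ex_series (fun k => Cmod (zterm a sg e k s * Cpow (P k) j)%C)).
  { intros j; apply ex_series_Cmod_le with (1 := HT j).
    now apply ex_series_scal_r. }
  set (elt := fun j => (Cpow (vexp a 0 s) (2 * j + e)
                        * cpow (1 + sg * rho ^ (2 * j + e)) (- s))%C).
  (* The difference of consecutive [T] contains the factor [1 - P k], which cancels the denominator
     of [zterm]. *)
  assert (Step : forall j, T j = (elt j + T (S j))%C).
  { intros j; set (n := (2 * j + e)%nat).
    assert (Rn : 0 < rho ^ n < 1).
    { split; [now apply pow_lt|]. apply pow_lt_1_compat; [lra|unfold n; lia]. }
    assert (Hx : Rabs (sg * rho ^ n) = rho ^ n).
    { rewrite Rabs_mult, Hsg, Rabs_pos_eq; lra. }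
    assert (Ab := ex_series_Cmod_binomial (- s)%C (sg * rho ^ n) ltac:(rewrite Hx; exact Rn)).
    unfold elt; fold n.
    rewrite <- CSeries_binomial by (rewrite Hx; apply Rn).
    rewrite <- CSeries_scal by assumption.
    unfold T; rewrite <- CSeries_plus.
    - apply CSeries_ext; intros k.
      (* This turns the sum over [k] into a binomial series in [sg * rho ^ n]. *)
      assert (Vn : Cpow (vexp a k s) n = (Cpow (vexp a 0 s) n * RtoC ((rho ^ n) ^ k))%C).
      { replace (vexp a k s) with (vexp a 0 s * RtoC (rho ^ k))%C.
        - rewrite Cpow_mult_l, Cpow_RtoC, <- !pow_mult, (Nat.mul_comm k n); reflexivity.
        - rewrite (vexp_split a k), (vexp_split a 0); fold rho; simpl pow; ring. }
      rewrite Rpow_mult_distr, RtoC_mult.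
      transitivity (cbinom (- s) k * RtoC (sg ^ k) * Cpow (vexp a k s) n
        + zterm a sg e k s * Cpow (P k) (S j))%C; [|rewrite Vn; ring].
      replace (Cpow (vexp a k s) n) with (Cpow (vexp a k s) e * Cpow (P k) j)%C.
      + unfold zterm; simpl Cpow; fold (P k); field; apply P1.
      + unfold P, n; rewrite Cpow_mult_l, Nat.add_comm, Cpow_add_r.
        replace (2 * j)%nat with (j + j)%nat by lia; rewrite Cpow_add_r; ring.
    - apply ex_series_ext with (fun k => Cmod (Cpow (vexp a 0 s) n)
        * Cmod (cbinom (- s) k * RtoC ((sg * rho ^ n) ^ k))%C).
      + intros k; now rewrite <- Cmod_mult.
      + exact (ex_series_scal_l _ _ Ab).
    - apply AT. }
  assert (Sum : forall N, sum_n elt N = (T 0%nat - T (S N))%C).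
  { induction N as [|N IH].
    - rewrite sum_O; change (elt 0%nat = T 0%nat - T 1%nat)%C.
      rewrite (Step 0%nat); ring.
    - rewrite sum_Sn, IH.
      change (T 0%nat - T (S N) + elt (S N) = T 0%nat - T (S (S N)))%C.
      rewrite (Step (S N)); ring. }
  assert (T0 : T 0%nat = CSeries (fun k => zterm a sg e k s)).
  { apply CSeries_ext; intros k; simpl; ring. }
  rewrite <- T0.
  set (B := 2 * Series (fun k => Cmod (zterm a sg e k s))).
  assert (HTB : forall N, Cmod (T N) <= B * th ^ N).
  { intros N; eapply Rle_trans.
    - apply Cmod_CSeries_le with (1 := HT N); now apply ex_series_scal_r.
    - rewrite Series_scal_r; unfold B; right; ring. }
  assert (Lim : is_lim_seq (fun N => B * th ^ S N) (B * 0)).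
  { apply is_lim_seq_mult'; [apply is_lim_seq_const|].
    apply (is_lim_seq_incr_1 (fun N => th ^ N)), is_lim_seq_geom.
    rewrite Rabs_pos_eq; lra. }
  rewrite Rmult_0_r in Lim.
  apply (proj2 (filterlim_locally (U := C_UniformSpace) (F := eventually) _ _)); intros eps.
  destruct (proj1 (filterlim_locally (F := eventually) _ _) Lim eps) as [N0 HN0].
  exists N0; intros N HN; specialize (HN0 N HN).
  change (Rabs (B * th ^ S N - 0) < eps) in HN0.
  change (ball (T 0%nat) eps (sum_n elt N)); rewrite Sum.
  assert (D : Cmod (T 0%nat - T (S N) - T 0%nat)%C < eps).
  { replace (T 0%nat - T (S N) - T 0%nat)%C with (- T (S N))%C by ring.
    rewrite Cmod_opp; eapply Rle_lt_trans; [apply HTB|].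
    eapply Rle_lt_trans; [|exact HN0]. rewrite Rminus_0_r; apply Rle_abs. }
  split.
  - eapply Rle_lt_trans; [exact (re_le_Cmod (T 0%nat - T (S N) - T 0%nat)%C)|exact D].
  - eapply Rle_lt_trans; [exact (im_le_Cmod (T 0%nat - T (S N) - T 0%nat)%C)|exact D].
Qed.

(** * Return to the stated series and to [F_D] *)

Lemma Cinv_0 : (/ 0)%C = 0%C.
Proof. apply injective_projections; simpl; unfold Rdiv; ring. Qed.

Lemma vexp_inv (eps : R) (k : nat) (s : C) :
  vexp (ln eps) k s = (/ cpow eps (s + RtoC (2 * INR k)))%C.
Proof. unfold vexp, cpow; rewrite <- cexp_opp; f_equal; ring. Qed.

Lemma cpow_double (eps : R) (k : nat) (s : C) :
  cpow eps (2 * s + RtoC (4 * INR k))%C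
  = (cpow eps (s + RtoC (2 * INR k)) * cpow eps (s + RtoC (2 * INR k)))%C.
Proof.
  unfold cpow; rewrite <- cexp_plus; f_equal.
  replace (4 * INR k) with (2 * INR k + 2 * INR k) by ring.
  rewrite RtoC_plus; ring.
Qed.

(* Both sides are [0] when [y * y = 1]. *)
Lemma Cinv_sqr_sub_1 (y : C) :
  y <> 0%C -> (/ (1 - / y * / y))%C = (y * y * / (y * y - 1))%C.
Proof.
  intros Hy.
  replace (1 - / y * / y)%C with ((y * y - 1) * / (y * y))%C by (field; assumption).
  set (w := (y * y - 1)%C).
  destruct (Ceq_dec w 0%C) as [->|Hw].
  - now rewrite Cmult_0_l, Cinv_0, Cmult_0_r.
  - field; split; assumption.
Qed.

Lemma odd_term_zterm (eps : R) (s : C) (k : nat) :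
  odd_term eps s k = zterm (ln eps) 1 1 k s.
Proof.
  unfold odd_term, zterm; rewrite cpow_double, vexp_inv, pow1.
  set (y := cpow eps (s + RtoC (2 * INR k))%C).
  assert (Hy : y <> 0%C) by apply cexp_neq_0.
  rewrite Cinv_sqr_sub_1 by assumption; unfold Cdiv.
  (* The identity holds for any value of the inverse, so poles need no separate case. *)
  generalize (/ (y * y - 1))%C; intros w; simpl; field; assumption.
Qed.

Lemma even_term_zterm (eps : R) (s : C) (k : nat) :
  even_term eps s k = zterm (ln eps) (-1) 2 k s.
Proof.
  unfold even_term, zterm; rewrite cpow_double, vexp_inv.
  set (y := cpow eps (s + RtoC (2 * INR k))%C).
  assert (Hy : y <> 0%C) by apply cexp_neq_0.
  rewrite Cinv_sqr_sub_1 by assumption; unfold Cdiv.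
  generalize (/ (y * y - 1))%C (RtoC ((-1) ^ k)); intros w u; simpl; field; assumption.
Qed.

Lemma cpow_mult_base (x y : R) (z : C) :
  0 < x -> 0 < y -> cpow (x * y) z = (cpow x z * cpow y z)%C.
Proof.
  intros Hx Hy; unfold cpow; rewrite <- cexp_plus, ln_mult, RtoC_plus by assumption.
  f_equal; ring.
Qed.

Lemma cpow_pow_opp (x : R) (n : nat) (s : C) :
  0 < x -> cpow (x ^ n) (- s) = Cpow (vexp (ln x) 0 s) n.
Proof.
  intros Hx; unfold cpow, vexp; rewrite <- cexp_mult_INR, ln_pow, RtoC_mult by assumption.
  f_equal; simpl INR; rewrite Rmult_0_r; ring.
Qed.

Lemma cpow_inv_sqrt_opp (q : R) (s : C) :
  0 < q -> cpow (/ sqrt q) (- s) = cpow q (s / 2).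
Proof.
  intros Hq; unfold cpow; f_equal.
  rewrite ln_Rinv by now apply sqrt_lt_R0.
  replace (ln q) with (ln (sqrt q * sqrt q)) by (now rewrite sqrt_sqrt by lra).
  rewrite ln_mult, RtoC_opp, RtoC_plus by now apply sqrt_lt_R0.
  field; apply RtoC_neq_0; lra.
Qed.

Lemma exp_m2_ln_pow (x : R) (n : nat) : 0 < x -> exp (-2 * ln x) ^ n = / x ^ n * / x ^ n.
Proof.
  intros Hx.
  replace (-2 * ln x) with (- ln x + - ln x) by ring.
  rewrite exp_plus, exp_Ropp, exp_ln, Rpow_mult_distr, pow_inv by assumption; reflexivity.
Qed.

Lemma qD_pos (D : Z) : (0 < D)%Z -> 0 < IZR (qD D).
Proof. intros HD; apply IZR_lt; unfold qD; destruct (Z.eqb _ _); lia. Qed.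

Lemma ln_pos (x : R) : 1 < x -> 0 < ln x.
Proof. intros Hx; rewrite <- ln_1; apply ln_increasing; lra. Qed.

(** The norm condition makes the conjugate [- / eps]. All three factors of [F_D] are then positive,
    which is what lets the principal power split. *)
Lemma cpow_F_D (D x y : Z) (sg : R) (n : nat) (s : C) :
  let eps := OD_elt D x y in
  (0 < D)%Z -> 1 < eps -> OD_norm D x y = -1 ->
  (0 < n)%nat -> Rabs sg = 1 -> (-1) ^ n = - sg ->
  cpow (F_D D x y n) (- s)
  = (cpow (IZR (qD D)) (s / 2) * (Cpow (vexp (ln eps) 0 s) n
       * cpow (1 + sg * exp (-2 * ln eps) ^ n) (- s)))%C.
Proof.
  intros eps HD Hgt HN Hn Habs Hsg.
  set (q := IZR (qD D)).
  assert (He : 0 < eps) by lra.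
  assert (Hen : 0 < eps ^ n) by now apply pow_lt.
  assert (Hq : 0 < q) by now apply qD_pos.
  assert (Hsq : 0 < sqrt q) by now apply sqrt_lt_R0.
  assert (Conj : OD_conj D x y = -1 * / eps).
  { unfold OD_norm in HN; fold eps in HN.
    rewrite <- HN; field; lra. }
  destruct (exp_neg_bounds _ (ln_pos _ Hgt)) as [R0 R1].
  assert (Hr : exp (-2 * ln eps) ^ n < 1) by (apply pow_lt_1_compat; [lra|assumption]).
  assert (Hr0 : 0 < exp (-2 * ln eps) ^ n) by now apply pow_lt.
  assert (Hpos : 0 < 1 + sg * exp (-2 * ln eps) ^ n).
  { assert (-1 <= sg) by (generalize (Rabs_maj2 sg); lra). nra. }
  replace (F_D D x y n) with (/ sqrt q * (eps ^ n * (1 + sg * exp (-2 * ln eps) ^ n))).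
  - rewrite cpow_mult_base, cpow_mult_base, cpow_inv_sqrt_opp, cpow_pow_opp; try assumption.
    + reflexivity.
    + now apply Rinv_0_lt_compat.
    + now apply Rmult_lt_0_compat.
  - unfold F_D; fold eps q; rewrite Conj, Rpow_mult_distr, Hsg, exp_m2_ln_pow, pow_inv by assumption.
    field; split; lra.
Qed.

Lemma Zodd_ext_zterm (D x y : Z) (s : C) :
  Zodd_ext D x y s = (cpow (IZR (qD D)) (s / 2) * CSeries (fun k => zterm (ln (OD_elt D x y)) 1 1 k s))%C.
Proof. unfold Zodd_ext; f_equal; apply CSeries_ext; intros k; apply odd_term_zterm. Qed.

Lemma Zeven_ext_zterm (D x y : Z) (s : C) :
  Zeven_ext D x y s = (cpow (IZR (qD D)) (s / 2) * CSeries (fun k => zterm (ln (OD_elt D x y)) (-1) 2 k s))%C.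
Proof. unfold Zeven_ext; f_equal; apply CSeries_ext; intros k; apply even_term_zterm. Qed.

(** Summation starts at [n = 0]: [e = 1] runs through the odd indices and [e = 2] through the even
    ones from 2 on, omitting [F_D] at 0. *)
Lemma is_series_F_D (D x y : Z) (sg : R) (e : nat) (s : C) :
  let eps := OD_elt D x y in
  (0 < D)%Z -> 1 < eps -> OD_norm D x y = -1 ->
  Rabs sg = 1 -> (0 < e)%nat -> (-1) ^ e = - sg -> 0 < Re s ->
  is_series (fun n => cpow (F_D D x y (2 * n + e)) (- s)%C)
    (cpow (IZR (qD D)) (s / 2) * CSeries (fun k => zterm (ln eps) sg e k s))%C.
Proof.
  intros eps HD Hgt HN Habs He Hsg Hs.
  eapply is_series_C_eq; [|reflexivity|
    exact (is_series_scal (V := C_NormedModule) (cpow (IZR (qD D)) (s / 2)) _ _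
      (is_series_zterm (ln eps) sg e s (ln_pos _ Hgt) Habs He Hs))].
  intros n; symmetry; apply cpow_F_D; try assumption; [lia|].
  rewrite pow_add, pow_mult, Hsg; replace ((-1) ^ 2) with 1 by ring; rewrite pow1; ring.
Qed.

Lemma hol_cpow_half (q : R) (s0 : C) : hol s0 (fun s => cpow q (s / 2)).
Proof.
  apply hol_ext with (fun s => cexp (RtoC (ln q / 2) * s)%C).
  - intros s; unfold cpow; f_equal; unfold Rdiv; rewrite RtoC_mult, RtoC_inv by lra.
    field; apply RtoC_neq_0; lra.
  - apply hol_cexp_scal.
Qed.

Lemma ex_derive_zterm_series (q eps sg : R) (e : nat) (s : C) :
  1 < eps -> Rabs sg = 1 -> (0 < e)%nat -> ~ pole_set eps s ->
  @ex_derive C_AbsRing C_NormedModule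
    (fun s => cpow q (s / 2) * CSeries (fun k => zterm (ln eps) sg e k s))%C s.
Proof.
  intros Hgt Habs He Hs; apply ex_derive_hol, hol_mult; [apply hol_cpow_half|].
  apply (hol_masked_zterm_series (ln eps) sg e (fun _ => true)); try assumption.
  - now apply ln_pos.
  - intros k _ E; apply Hs; exists k; now apply (vexp_sqr_eq_1 _ _ _ (ln_pos _ Hgt)).
Qed.

Lemma simple_pole_zterm_series (q eps sg : R) (e : nat) (s0 : C) :
  1 < eps -> Rabs sg = 1 -> (0 < e)%nat -> pole_set eps s0 ->
  simple_pole (fun s => cpow q (s / 2) * CSeries (fun k => zterm (ln eps) sg e k s))%C s0.
Proof.
  intros Hgt Habs He Hs0.
  apply zterm_series_simple_pole; try assumption.
  - now apply ln_pos.
  - apply hol_cpow_half.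
  - apply cexp_neq_0.
Qed.

Lemma simple_pole_ext (f g : C -> C) (s0 : C) :
  (forall s, f s = g s) -> simple_pole f s0 -> simple_pole g s0.
Proof.
  intros E (c & Hc & H); exists c; split; [assumption|].
  revert H; apply filterlim_ext; intros s; now rewrite E.
Qed.

Theorem mainTheorem3 (D x y : Z) :
  (0 < D)%Z -> squarefree D ->
  is_fund_unit D x y -> OD_norm D x y = -1 ->
  let eps := OD_elt D x y in
  (* absolute convergence of the series away from the poles of the summands *)
  (forall s : C, ~ pole_set eps s ->
     ex_series (fun k => Cmod (odd_term eps s k)) /\
     ex_series (fun k => Cmod (even_term eps s k))) /\
  (* agreement with the Dirichlet series for Re s > 0 *)
  (forall s : C, 0 < Re s ->
     is_series (fun n => cpow (F_D D x y (2 * n + 1)) (- s)) (Zodd_ext D x y s) /\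
     is_series (fun n => cpow (F_D D x y (2 * n + 2)) (- s)) (Zeven_ext D x y s)) /\
  (* meromorphic on C: holomorphic off the pole set ... *)
  (forall s : C, ~ pole_set eps s ->
     @ex_derive C_AbsRing C_NormedModule (Zodd_ext D x y) s /\
     @ex_derive C_AbsRing C_NormedModule (Zeven_ext D x y) s) /\
  (* ... with simple poles at every point of it *)
  (forall s0 : C, pole_set eps s0 ->
     simple_pole (Zodd_ext D x y) s0 /\ simple_pole (Zeven_ext D x y) s0).
Proof.
  intros HD _ [_ [Hgt _]] HN eps.
  assert (Ha := ln_pos _ Hgt); fold eps in Ha.
  assert (A1 : Rabs 1 = 1) by apply Rabs_R1.
  assert (A2 : Rabs (-1) = 1) by (rewrite Rabs_left; lra).
  repeat split.
  - eapply ex_series_ext; [|exact (ex_series_Cmod_zterm (ln eps) 1 1 s Ha A1 ltac:(lia))].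
    intros k; now rewrite odd_term_zterm.
  - eapply ex_series_ext; [|exact (ex_series_Cmod_zterm (ln eps) (-1) 2 s Ha A2 ltac:(lia))].
    intros k; now rewrite even_term_zterm.
  - rewrite Zodd_ext_zterm; apply is_series_F_D; try assumption; [lia|ring].
  - rewrite Zeven_ext_zterm; apply is_series_F_D; try assumption; [lia|ring].
  - eapply ex_derive_ext; [|apply (ex_derive_zterm_series (IZR (qD D)) eps 1 1); try eassumption; lia].
    intros t; symmetry; apply Zodd_ext_zterm.
  - eapply ex_derive_ext; [|apply (ex_derive_zterm_series (IZR (qD D)) eps (-1) 2); try eassumption; lia].
    intros t; symmetry; apply Zeven_ext_zterm.
  - eapply simple_pole_ext; [|apply (simple_pole_zterm_series (IZR (qD D)) eps 1 1); try eassumption; lia].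
    intros t; symmetry; apply Zodd_ext_zterm.
  - eapply simple_pole_ext; [|apply (simple_pole_zterm_series (IZR (qD D)) eps (-1) 2); try eassumption; lia].
    intros t; symmetry; apply Zeven_ext_zterm.
Qed.
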